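(* Define formal power series $$\varphi_0(y,\kappa):=y+\sum_{n=3}^{\infty}n\,\kappa\,y^{n-1}\,\widetilde\chi_{0,n}(\kappa),\qquad \varphi_g(y,\kappa):=\sum_{n=1}^\infty n\,\kappa\,y^{n-1}\,\widetilde\chi_{g,n}(\kappa)\quad(g\ge1).$$ Then for every $g\ge1$, $$(y+1)\varphi_g'+(2g-1)\varphi_g=\frac12\kappa^2\varphi_{g-1}''+\kappa\sum_{g_1+g_2=g}\varphi_{g_1}'\varphi_{g_2},$$ where the sum is over $g_1,g_2\ge0$ and $'$ denotes $\frac{\partial}{\partial y}$.
   Context: Stable graphs: a stable graph is a finite graph (loops and multiple edges allowed) with internal edges, each joining two (possibly equal) vertices, and unlabelled external edges, each attached to one vertex. Each vertex $v$ carries a genus $g_v\in\mathbb Z_{\ge0}$; its valence $\mathrm{val}_v$ is the number of half-edges at $v$ (an external edge counts once, a loop twice); stability means $2g_v-2+\mathrm{val}_v>0$ for every $v$. The genus of a connected stable graph $\Gamma$ is $h^1(\Gamma)+\sum_v g_v$. $\mathcal G^c_{g,n}$ is the (finite) set of isomorphism classes of connected stable graphs of genus $g$ with $n$ external edges, $V(\Gamma)$ and $E(\Gamma)$ are the sets of vertices and internal edges, and $\mathrm{Aut}(\Gamma)$ is the automorphism group (acting on vertices and half-edges; external edges may be permuted). For $2g-2+n>0$, $\chi(\mathcal M_{g,n})$ is the orbifold Euler characteristic of the moduli space of smooth genus $g$ curves with $n$ marked points, given by the Harer–Zagier formula $\chi(\mathcal M_{g,n})=(-1)^n\frac{(2g-1)B_{2g}}{(2g)!}(2g+n-3)!$.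 The refined orbifold Euler characteristic (at $t=1$) is the polynomial $$\widetilde\chi_{g,n}(\kappa):=\sum_{\Gamma\in\mathcal G^c_{g,n}}\frac{\kappa^{|E(\Gamma)|}}{|\mathrm{Aut}(\Gamma)|}\prod_{v\in V(\Gamma)}\chi(\mathcal M_{g_v,\mathrm{val}_v}).$$ *)

(* Defs.v *)
From HB Require Import structures.
From mathcomp Require Import all_boot all_order all_fingroup all_algebra.
From mathcomp Require Import generic_quotient boolp classical_sets functions.
From mathcomp Require Import cardinality fsbigop.

Set Implicit Arguments.
Unset Strict Implicit.
Unset Printing Implicit Defensive.

Import GRing.Theory.
Local Open Scope ring_scope.

Record fps (R : comNzRingType) := Fps { fpscoef : nat -> R }.

Section FormalPowerSeries.
Variable R : comNzRingType.
Implicit Types f g h : fps R.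

Lemma fpsP f g : fpscoef f =1 fpscoef g -> f = g.
Proof. by case: f g => [f] [g] /= /funext ->. Qed.

HB.instance Definition _ := gen_eqMixin (fps R).
HB.instance Definition _ := gen_choiceMixin (fps R).

Definition fpsadd f g := Fps (fun n => fpscoef f n + fpscoef g n).
Definition fpsopp f := Fps (fun n => - fpscoef f n).
Definition fpsconst (c : R) := Fps (fun n => c *+ (n == 0)).
Definition fpsmul f g :=
  Fps (fun n => \sum_(i < n.+1) fpscoef f i * fpscoef g (n - i)).

Fact fpsaddA : associative fpsadd.
Proof. by move=> f g h; apply: fpsP => n /=; rewrite addrA. Qed.
Fact fpsaddC : commutative fpsadd.
Proof. by move=> f g; apply: fpsP => n /=; rewrite addrC. Qed.
Fact fpsadd0 : left_id (fpsconst 0) fpsadd.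
Proof. by move=> f; apply: fpsP => n /=; rewrite mul0rn add0r. Qed.
Fact fpsaddN : left_inverse (fpsconst 0) fpsopp fpsadd.
Proof. by move=> f; apply: fpsP => n /=; rewrite mul0rn addNr. Qed.

HB.instance Definition _ :=
  GRing.isZmodule.Build (fps R) fpsaddA fpsaddC fpsadd0 fpsaddN.

Let trunc N f : {poly R} := \poly_(i < N) fpscoef f i.

Let coef_fpsmul N f g n : (n < N)%N ->
  fpscoef (fpsmul f g) n = (trunc N f * trunc N g)`_n.
Proof.
move=> ltnN; rewrite coefM; apply: eq_bigr => i _; rewrite !coef_poly.
have lei : (i <= n)%N by rewrite -ltnS.
by rewrite (leq_ltn_trans lei ltnN) (leq_ltn_trans (leq_subr i n) ltnN).
Qed.

Fact fpsmulA : associative fpsmul.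
Proof.
move=> f g h; apply: fpsP => n.
rewrite !(@coef_fpsmul n.+1) //.
transitivity (trunc n.+1 f * (trunc n.+1 g * trunc n.+1 h))`_n.
  rewrite !coefM; apply: eq_bigr => i _; congr (_ * _).
  by rewrite coef_poly ltnS leq_subr (@coef_fpsmul n.+1) // ltnS leq_subr.
rewrite mulrA !coefM; apply: eq_bigr => i _; congr (_ * _).
by rewrite [in RHS]coef_poly ltn_ord (@coef_fpsmul n.+1).
Qed.

Fact fpsmulC : commutative fpsmul.
Proof.
by move=> f g; apply: fpsP => n; rewrite !(@coef_fpsmul n.+1) // mulrC.
Qed.

Fact fpsmul1 : left_id (fpsconst 1) fpsmul.
Proof.
move=> f; apply: fpsP => n /=.
by rewrite big_ord_recl /= mul1r subn0 big1 ?addr0 // => i _; rewrite mul0r.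
Qed.

Fact fpsmulDl : left_distributive fpsmul fpsadd.
Proof.
move=> f g h; apply: fpsP => n /=.
by rewrite -big_split; apply: eq_bigr => i _; rewrite mulrDl.
Qed.

Fact fps1_neq0 : fpsconst 1 != 0.
Proof.
apply/eqP => /(congr1 (fun f => fpscoef f 0)) /= /eqP.
by rewrite oner_eq0.
Qed.

HB.instance Definition _ := GRing.Zmodule_isComNzRing.Build (fps R)
  fpsmulA fpsmulC fpsmul1 fpsmulDl fps1_neq0.

Definition fpsvar : fps R := Fps (fun n => (n == 1)%:R).
Definition fpsderiv f : fps R := Fps (fun n => fpscoef f n.+1 *+ n.+1).

End FormalPowerSeries.

Arguments fpsvar {R}.

(* [bernoulli_seq n] is [:: B_0; ...; B_(n-1)], computed from
   \sum_(k <= m) 'C(m.+1, k) * B_k = (m == 0). *)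
Fixpoint bernoulli_seq (n : nat) : seq rat :=
  if n is m.+1 then
    let s := bernoulli_seq m in
    rcons s (((m == 0)%:R - \sum_(k < m) 'C(m.+1, k)%:R * s`_k) / m.+1%:R)
  else [::].

Definition bernoulli (n : nat) : rat := (bernoulli_seq n.+1)`_n.

Lemma size_bernoulli_seq n : size (bernoulli_seq n) = n.
Proof. by elim: n => //= n IHn; rewrite size_rcons IHn. Qed.

Lemma nth_bernoulli_seq n k : (k < n)%N -> (bernoulli_seq n)`_k = bernoulli k.
Proof.
elim: n => // n IHn; rewrite ltnS leq_eqVlt => /predU1P[-> //|ltkn].
by rewrite /= nth_rcons size_bernoulli_seq ltkn IHn.
Qed.

Lemma bernoulli_rec n :
  \sum_(k < n.+1) 'C(n.+1, k)%:R * bernoulli k = (n == 0)%:R.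
Proof.
rewrite big_ord_recr /= binSn {2}/bernoulli /= nth_rcons size_bernoulli_seq.
rewrite ltnn eqxx [X in _ + X]mulrC divfK ?Num.Theory.pnatr_eq0 //.
under [X in _ - X]eq_bigr => k _ do rewrite nth_bernoulli_seq //.
by rewrite addrC subrK.
Qed.

(* The Harer-Zagier formula for the orbifold Euler characteristic of M_{g,n};
   only used when 2g - 2 + n > 0, so that [2 * g + n - 3] is not truncated. *)
Definition chiM (g n : nat) : rat :=
  (-1) ^+ n * (((2 * g)%:R - 1) * bernoulli (2 * g) / (2 * g)`!%:R)
    * (2 * g + n - 3)`!%:R.

(* A graph is given by its vertices and half-edges: [root h] is the vertex to
   which the half-edge [h] is attached, and the involution [flip] exchanges the
   two halves of every internal edge and fixes the external edges. Both sets
   are skeletal ([ordinal]s), which loses nothing up to isomorphism. *)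
Definition valence_of nv nh (root : 'I_nh -> 'I_nv) (v : 'I_nv) : nat :=
  #|[set h | root h == v]|.

Record stable_graph := StableGraph {
  nv : nat;
  nh : nat;
  vgenus : 'I_nv -> nat;
  root : 'I_nh -> 'I_nv;
  flip : 'I_nh -> 'I_nh;
  flipK : involutive flip;
  stability : forall v, (2 < 2 * vgenus v + valence_of root v)%N
}.

HB.instance Definition _ := gen_eqMixin stable_graph.
HB.instance Definition _ := gen_choiceMixin stable_graph.

Section StableGraphTheory.
Variable G : stable_graph.

Definition valence : 'I_(nv G) -> nat := valence_of (@root G).

Definition external_edges : {set 'I_(nh G)} := [set h | flip h == h].

Definition internal_edges : {set {set 'I_(nh G)}} :=
  [set [set h; flip h] | h in [set h | flip h != h]].

Definition adjacent (u v : 'I_(nv G)) : bool :=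
  [exists h, (root h == u) && (root (flip h) == v)].

Definition connected_graph : bool :=
  (0 < nv G)%N && [forall u, forall v, connect adjacent u v].

(* The cellular coboundary d : C^0 -> C^1, acting on row vectors by
   (d f)(h) = f (root (flip h)) - f (root h). Here C^1 is the space of functions
   c on half-edges with c (flip h) = - c h; it has dimension the number of
   internal edges, so h^1 = dim (C^1 / im d) is as below. *)
Definition coboundary : 'M[rat]_(nv G, nh G) :=
  \matrix_(v, h) ((root (flip h) == v)%:R - (root h == v)%:R).

Definition h1 : nat := #|internal_edges| - \rank coboundary.

Definition graph_genus : nat := h1 + \sum_(v < nv G) vgenus v.

Definition automorphisms : {set {perm 'I_(nv G)} * {perm 'I_(nh G)}} :=
  [set s : {perm 'I_(nv G)} * {perm 'I_(nh G)} |
            [forall v, vgenus (s.1 v) == vgenus v]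
         && [forall h, (root (s.2 h) == s.1 (root h))
                    && (flip (s.2 h) == s.2 (flip h))]].

Definition weight : {poly rat} :=
  (\prod_(v < nv G) chiM (vgenus v) (valence v) / #|automorphisms|%:R)
    *: 'X^#|internal_edges|.

End StableGraphTheory.

Definition isomorphic (G G' : stable_graph) : Prop :=
  exists (a : 'I_(nv G) -> 'I_(nv G')) (b : 'I_(nh G) -> 'I_(nh G')),
    [/\ bijective a, bijective b,
        forall v, vgenus (a v) = vgenus v,
        forall h, root (b h) = a (root h)
      & forall h, flip (b h) = b (flip h)].

Definition iso_rel : rel stable_graph := fun G G' => `[< isomorphic G G' >].

Fact iso_rel_refl : reflexive iso_rel.
Proof.
move=> G; apply/asboolP; exists id, id.
by split=> //; exists id.
Qed.

Lemma isomorphic_sym G G' : isomorphic G G' -> isomorphic G' G.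
Proof.
case=> a [b [[a' aK a'K] [b' bK b'K] ga rb fb]]; exists a', b'.
split; [by exists a | by exists b | | |].
- by move=> v; rewrite -ga a'K.
- by move=> h; apply: (can_inj aK); rewrite -rb b'K a'K.
- by move=> h; apply: (can_inj bK); rewrite -fb !b'K.
Qed.

Fact iso_rel_sym : symmetric iso_rel.
Proof.
by move=> G G'; apply/asboolP/asboolP; apply: isomorphic_sym.
Qed.

Fact iso_rel_trans : transitive iso_rel.
Proof.
move=> G2 G1 G3 /asboolP[a [b [bija bijb ga rb fb]]].
move=> /asboolP[a' [b' [bija' bijb' ga' rb' fb']]].
apply/asboolP; exists (a' \o a), (b' \o b); split.
- exact: bij_comp.
- exact: bij_comp.
- by move=> v /=; rewrite ga' ga.
- by move=> h /=; rewrite rb' rb.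
- by move=> h /=; rewrite fb' fb.
Qed.

Canonical iso_equiv := EquivRel iso_rel iso_rel_refl iso_rel_sym iso_rel_trans.

Definition iso_class := {eq_quot iso_rel}%qT.
HB.instance Definition _ : EqQuotient _ iso_rel iso_class :=
  EqQuotient.on iso_class.
HB.instance Definition _ := Choice.on iso_class.

Definition connected_iso_classes (g n : nat) : set iso_class :=
  [set (\pi_iso_class G)%qT | G in
    [set G | [/\ connected_graph G, graph_genus G = g
               & #|external_edges G| = n]]]%classic.

(* The refined orbifold Euler characteristic at t = 1; ['X] stands for kappa.
   The sum over classes is the finitely supported one of [fsbigop]. *)
Definition refined_chi (g n : nat) : {poly rat} :=
  \sum_(C \in connected_iso_classes g n) weight (repr C).

(* The coefficient of y^m in [phi g] is the term of index n = m + 1. *)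
Definition phi (g : nat) : fps {poly rat} :=
  let term n : {poly rat} := n%:R * 'X * refined_chi g n in
  if g == 0%N then fpsvar + Fps (fun m => if (3 <= m.+1)%N then term m.+1 else 0)
  else Fps (fun m => term m.+1).

Definition kappa : fps {poly rat} := fpsconst 'X.

(* Main.v *)
Require Import Defs.
From mathcomp Require Import boolp classical_sets fsbigop.
From mathcomp Require Import all_boot all_order all_algebra.
From mathcomp Require Import all_fingroup generic_quotient.
From mathcomp Require Import zify ring.

Set Implicit Arguments.
Unset Strict Implicit.
Unset Printing Implicit Defensive.

Import GRing.Theory Num.Theory.
Local Open Scope ring_scope.

(** Give a stable graph the weight that multiplies the numbers chi(M_{g_v,val_v})
    over its vertices, kappa over its internal edges and y over its external
    edges, divides by the order of the automorphism group, and is marked by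
    t^D, where D is the sum over the vertices of 2 g_v - 2 + val_v. Let Z be the
    sum of the weights of all stable graphs, and F that of the connected ones.
    For a connected graph D = 2 g - 2 + n, so the coefficient of t^(2g-2+n) y^n
    in F is the refined Euler characteristic of type (g, n).

    The proof forgets an external edge. By the Harer-Zagier formula,
    chi(M_{g,n+1}) = - (2g - 2 + n) chi(M_{g,n}), except that the types (0,3)
    and (1,1) arise from unstable ones ([stable_chiS]); this is a differential
    equation for the generating function of the vertices ([vertex_egf_eq]).
    All graphs are obtained by pairing some of the half-edges of a set of
    vertices. The m half-edges contribute the two-variable Hermite polynomial
    h_m(y, kappa) ([invol_sumE]), and multiplying a vertex series by y amounts to
    applying y + kappa d/dy to Z ([herm_der]). So Z satisfies the linear
    equation ([linear_all_gf])
      dZ/dy = t (1/2 (y + kappa d/dy)^2 Z + c Z - t dZ/dt),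
    where c = chi(M_{1,1}). The three terms of the square remember what the two
    other half-edges of a forgotten vertex of type (0,3) were attached to.

    Splitting off one component of a graph ([labelled_split]) gives
    t dZ/dt = (t dF/dt) Z, which forces dZ/dy = (dF/dy) Z ([der_all_gf]): this is
    Z = exp F without the exponential. Dividing the linear equation by Z leaves
    a quadratic one for F ([quadratic_conn_gf]), whose coefficients give a
    recursion for the refined Euler characteristics ([refined_chi_rec]). The
    series phi_g is kappa times the y-derivative of the genus g part of F, plus y
    if g = 0; the theorem is kappa times the y-derivative of the recursion, and
    the constant c disappears in the differentiation.

    Sums over isomorphism classes are turned into sums over graphs on fixed sets
    of k vertices and m half-edges, divided by k! m!, by the orbit-stabiliser
    theorem ([refined_chi_labelled]). The genus of a connected graph comes from
    the rank of the coboundary matrix ([rank_coboundary]). *)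

(** * Graphs on given sets of vertices and half-edges *)

Section RawGraph.
Variables V H : finType.
Implicit Types (r : H -> V) (f : H -> H).

Definition degree_at r v := #|[set h | r h == v]|.
Definition edge_adj r f : rel V :=
  fun u v => [exists h, (r h == u) && (r (f h) == v)].
Definition graph_conn r f :=
  (0 < #|V|)%N && [forall u, forall v, connect (edge_adj r f) u v].
Definition n_ext f := #|[set h | f h == h]|.
Definition n_int f := #|[set [set h; f h] | h in [set h | f h != h]]|.

Lemma degree_atE r v : degree_at r v = (\sum_h (r h == v))%N.
Proof. by rewrite /degree_at -sum1dep_card big_mkcond; apply: eq_bigr => h _; case: ifP. Qed.

Lemma n_extE f : n_ext f = (\sum_h (f h == h))%N.
Proof. by rewrite /n_ext -sum1dep_card big_mkcond; apply: eq_bigr => h _; case: ifP. Qed.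

(** The orbits of the involution are the internal edges, of size two, and the
    external half-edges. *)
Lemma card_halves f : involutive f -> #|H| = (n_ext f + 2 * n_int f)%N.
Proof.
move=> fK; rewrite -cardsT.
rewrite -(cardsID [set h | f h == h] [set: H]) setTI; congr (_ + _)%N.
have -> : [set: H] :\: [set h | f h == h] = [set h | f h != h].
  by apply/setP => h; rewrite !inE andbT.
rewrite mulnC; apply: card_uniform_partition.
  move=> e /imsetP[h]; rewrite inE => nh ->; rewrite cards2 eq_sym nh //.
apply/and3P; split.
- apply/eqP/setP => h; rewrite inE; apply/bigcupP/idP.
    case=> e /imsetP[i]; rewrite inE => ni -> /set2P[] -> //.
    by rewrite fK eq_sym.
  move=> nh; exists [set h; f h]; last by rewrite !inE eqxx.
  by apply/imsetP; exists h; rewrite ?inE.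
- apply/trivIsetP => _ _ /imsetP[h _ ->] /imsetP[i _ ->] ne.
  rewrite -setI_eq0; apply/eqP/setP => j; rewrite !inE.
  apply/negbTE/negP => /andP[jh ji]; case/negP: ne; apply/eqP.
  have sw k : [set f k; f (f k)] = [set k; f k] by rewrite fK setUC.
  by case/orP: jh ji => /eqP-> /orP[] /eqP E; rewrite -?E ?sw // -(sw h) ?E ?sw // -(sw i) -E fK.
- apply/imsetP => -[h _ /setP/(_ h)]; by rewrite !inE eqxx.
Qed.

Lemma edge_adj_sym r f : involutive f -> symmetric (edge_adj r f).
Proof.
move=> fK u v; apply/existsP/existsP => -[h /andP[/eqP h1 /eqP h2]];
  by exists (f h); rewrite fK h1 h2 !eqxx.
Qed.

Lemma edge_connect_sym r f : involutive f -> connect_sym (edge_adj r f).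
Proof. by move=> fK; apply: sym_connect_sym; apply: edge_adj_sym. Qed.

End RawGraph.

Section Lab.
Variable N : nat.

(** A genus below [N] for each vertex, the vertex of each half-edge and the
    candidate for the involution. The bound makes the type finite; every equation
    below holds for each [N] large enough. *)
Definition labelled (V H : finType) : finType :=
  ({ffun V -> 'I_N} * {ffun H -> V} * {ffun H -> H})%type.

Variables (A : comNzRingType) (X : nat -> nat -> A) (y k : A) (s : nat -> nat -> nat).

Section LabDefs.
Variables V H : finType.
Implicit Types x : labelled V H.
Definition lgenus x (v : V) : nat := x.1.1 v.
Definition lvalid x := [forall h, x.2 (x.2 h) == h].
Definition lconn x := graph_conn x.1.2 x.2.
Definition vertex_part x : A := \prod_v X (lgenus x v) (degree_at x.1.2 v).
Definition edge_part (f : {ffun H -> H}) : A := y ^+ n_ext f * k ^+ n_int f.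
Definition lweight x : A := vertex_part x * edge_part x.2.
Definition lstat x : nat := (\sum_v s (lgenus x v) (degree_at x.1.2 v))%N.

Lemma lvalidP x : reflect (involutive x.2) (lvalid x).
Proof. by apply: (iffP forallP) => xK h; apply/eqP. Qed.
End LabDefs.

(** * Splitting off a component *)
Section Glue.
Variables V1 V2 V H1 H2 H : finType.
Variables (a : V1 + V2 -> V) (a' : V -> V1 + V2) (b : H1 + H2 -> H) (b' : H -> H1 + H2).
Hypotheses (aK : cancel a a') (aK' : cancel a' a) (bK : cancel b b') (bK' : cancel b' b).

(** The disjoint union of two graphs, carried along bijections of the disjoint
    unions of their vertices and half-edges with given sets. *)
Definition glue (x : labelled V1 H1 * labelled V2 H2) : labelled V H :=
  ([ffun v => match a' v with inl u => x.1.1.1 u | inr u => x.2.1.1 u end],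
   [ffun h => match b' h with inl i => a (inl (x.1.1.2 i))
                            | inr i => a (inr (x.2.1.2 i)) end],
   [ffun h => match b' h with inl i => b (inl (x.1.2 i))
                            | inr i => b (inr (x.2.2 i)) end]).

Let aI := can_inj aK.
Let bI := can_inj bK.

Lemma glue_g1 x u : (glue x).1.1 (a (inl u)) = x.1.1.1 u. Proof. by rewrite ffunE aK. Qed.
Lemma glue_g2 x u : (glue x).1.1 (a (inr u)) = x.2.1.1 u. Proof. by rewrite ffunE aK. Qed.
Lemma glue_r1 x u : (glue x).1.2 (b (inl u)) = a (inl (x.1.1.2 u)). Proof. by rewrite ffunE bK. Qed.
Lemma glue_r2 x u : (glue x).1.2 (b (inr u)) = a (inr (x.2.1.2 u)). Proof. by rewrite ffunE bK. Qed.
Lemma glue_f1 x u : (glue x).2 (b (inl u)) = b (inl (x.1.2 u)). Proof. by rewrite ffunE bK. Qed.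
Lemma glue_f2 x u : (glue x).2 (b (inr u)) = b (inr (x.2.2 u)). Proof. by rewrite ffunE bK. Qed.
Definition glueE := (glue_g1, glue_g2, glue_r1, glue_r2, glue_f1, glue_f2).

Lemma glue_inj : injective glue.
Proof.
move=> [[[g1 r1] f1] [[g2 r2] f2]] [[[g3 r3] f3] [[g4 r4] f4]] E.
have Eg v := congr1 (fun z : labelled V H => z.1.1 v) E.
have Er h := congr1 (fun z : labelled V H => z.1.2 h) E.
have Ef h := congr1 (fun z : labelled V H => z.2 h) E.
congr ((_, _, _), (_, _, _)); apply/ffunP => i.
- by have := Eg (a (inl i)); rewrite !glueE.
- by have := Er (b (inl i)); rewrite !glueE => /aI[].
- by have := Ef (b (inl i)); rewrite !glueE => /bI[].
- by have := Eg (a (inr i)); rewrite !glueE.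
- by have := Er (b (inr i)); rewrite !glueE => /aI[].
- by have := Ef (b (inr i)); rewrite !glueE => /bI[].
Qed.

Lemma big_glued_vertices (R : Type) (idx : R) (op : Monoid.com_law idx) (F : V -> R) :
  \big[op/idx]_v F v = op (\big[op/idx]_u F (a (inl u))) (\big[op/idx]_u F (a (inr u))).
Proof. by rewrite (reindex a) ?big_sumType //; exists a' => v _. Qed.

Lemma big_glued_halves (R : Type) (idx : R) (op : Monoid.com_law idx) (F : H -> R) :
  \big[op/idx]_v F v = op (\big[op/idx]_u F (b (inl u))) (\big[op/idx]_u F (b (inr u))).
Proof. by rewrite (reindex b) ?big_sumType //; exists b' => v _. Qed.

Lemma glue_degree1 x u : degree_at (glue x).1.2 (a (inl u)) = degree_at x.1.1.2 u.
Proof.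
rewrite !degree_atE big_glued_halves /= [X in (_ + X)%N]big1 ?addn0 => [|i _]; last first.
  by rewrite glueE (inj_eq aI).
by apply: eq_bigr => i _; rewrite glueE (inj_eq aI).
Qed.
Lemma glue_degree2 x u : degree_at (glue x).1.2 (a (inr u)) = degree_at x.2.1.2 u.
Proof.
rewrite !degree_atE big_glued_halves /= [X in (X + _)%N]big1 ?add0n => [|i _]; last first.
  by rewrite glueE (inj_eq aI).
by apply: eq_bigr => i _; rewrite glueE (inj_eq aI).
Qed.

Lemma glue_valid x : lvalid (glue x) = lvalid x.1 && lvalid x.2.
Proof.
apply/forallP/andP => [fK|[/lvalidP fK1 /lvalidP fK2] h].
  by split; apply/forallP => i; [have := fK (b (inl i)) | have := fK (b (inr i))];
    rewrite !glueE (inj_eq bI).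
by rewrite -[h]bK'; case: (b' h) => i; rewrite !glueE (fK1, fK2).
Qed.

Lemma glue_ext x : n_ext (glue x).2 = (n_ext x.1.2 + n_ext x.2.2)%N.
Proof.
rewrite !n_extE big_glued_halves /=; congr (_ + _)%N;
  by apply: eq_bigr => i _; rewrite glueE (inj_eq bI).
Qed.

(** The number of internal edges is additive because the numbers of half-edges
    and of external edges are. *)
Lemma glue_int x : lvalid (glue x) -> n_int (glue x).2 = (n_int x.1.2 + n_int x.2.2)%N.
Proof.
move=> I; have := I; rewrite glue_valid => /andP[I1 I2].
have := card_halves (lvalidP _ I); have := card_halves (lvalidP _ I1).
have := card_halves (lvalidP _ I2); rewrite glue_ext.
have -> : #|H| = (#|H1| + #|H2|)%N by rewrite -card_sum; apply/esym/bij_eq_card; exists b'; eauto.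
lia.
Qed.

Lemma glue_weight x : lvalid (glue x) -> lweight (glue x) = lweight x.1 * lweight x.2.
Proof.
move=> I; rewrite /lweight /edge_part glue_ext glue_int // !exprD.
have -> : vertex_part (glue x) = vertex_part x.1 * vertex_part x.2.
  by rewrite /vertex_part big_glued_vertices; congr (_ * _); apply: eq_bigr => u _;
    rewrite /lgenus glueE (glue_degree1, glue_degree2).
by rewrite [X in _ * X = _]mulrACA [LHS]mulrACA.
Qed.

Lemma glue_connect_inv x u w : connect (edge_adj (glue x).1.2 (glue x).2) (a (inl u)) w ->
  exists2 v, w = a (inl v) & connect (edge_adj x.1.1.2 x.1.2) u v.
Proof.
case/connectP => p; elim: p u => [|z p IH] u /=; first by move=> _ ->; exists u.
case/andP => /existsP[h /andP[]]; rewrite -[h]bK'; case: (b' h) => i; rewrite !glueE.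
  rewrite (inj_eq aI) => /eqP[<-] /eqP <- /IH{}IH /IH[v -> c]; exists v => //.
  apply: connect_trans c; apply: connect1; apply/existsP; exists i.
  by rewrite !eqxx.
by rewrite (inj_eq aI).
Qed.

Lemma glue_connect (x : labelled V1 H1 * labelled V2 H2) u v : connect (edge_adj x.1.1.2 x.1.2) u v ->
  connect (edge_adj (glue x).1.2 (glue x).2) (a (inl u)) (a (inl v)).
Proof.
case/connectP => p; elim: p u => [|z p IH] u /=; first by move=> _ ->.
case/andP => /existsP[i /andP[/eqP <- /eqP <-]] /IH{}IH /IH; apply: connect_trans.
by apply: connect1; apply/existsP; exists (b (inl i)); rewrite !glueE !eqxx.
Qed.

Definition component_of (x : labelled V H) v : {set V} := [set w | connect (edge_adj x.1.2 x.2) v w].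

(** The first summand of a disjoint union is a component exactly when it is
    connected. *)
Lemma glue_component x w : lvalid x.1 ->
  (component_of (glue x) w == [set a (inl u) | u : V1]) =
  lconn x.1 && (w \in [set a (inl u) | u : V1]).
Proof.
move=> I; apply/eqP/andP => [E|[/andP[_ /forallP c] /imsetP[u _ ->]]].
  have win: w \in [set a (inl u) | u : V1] by rewrite -E inE.
  split=> //; case/imsetP: win E => u _ -> E; apply/andP; split.
    by apply/card_gt0P; exists u.
  have cu v : connect (edge_adj x.1.1.2 x.1.2) u v.
    have : a (inl v) \in [set a (inl u) | u : V1] by apply/imsetP; exists v.
    by rewrite -E inE => /glue_connect_inv[v' /aI[->]].
  apply/forallP => v; apply/forallP => v'; apply: connect_trans (cu v').
  by rewrite edge_connect_sym //; apply/lvalidP.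
apply/setP => v; rewrite inE; apply/idP/imsetP.
  by case/glue_connect_inv => z -> _; exists z.
by case=> z _ ->; apply: glue_connect; have /forallP := c u.
Qed.

Lemma glue_stat x : lvalid x.1 ->
  (\sum_(w | component_of (glue x) w == [set a (inl u) | u : V1])
      s (lgenus (glue x) w) (degree_at (glue x).1.2 w)
  = if lconn x.1 then lstat x.1 else 0)%N.
Proof.
move=> I; rewrite big_mkcond big_glued_vertices /= [X in (_ + X)%N]big1 ?addn0 => [|u _]; last first.
  rewrite glue_component //; case: imsetP => [[v _ /aI]//|_]; by rewrite andbF.
case: ifP => c; last by rewrite big1 // => u _; rewrite glue_component // c.
apply: eq_bigr => u _; rewrite glue_component // c /=.
by rewrite imset_f // /lgenus glueE glue_degree1.
Qed.

Lemma glue_onto (z : labelled V H) : (forall i, z.1.2 (b (inl i)) \in [set a (inl u) | u : V1]) ->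
  (forall i, z.1.2 (b (inr i)) \notin [set a (inl u) | u : V1]) ->
  (forall i, z.2 (b (inl i)) \in [set b (inl u) | u : H1]) ->
  (forall i, z.2 (b (inr i)) \notin [set b (inl u) | u : H1]) ->
  exists x, z = glue x.
Proof.
have sa (v : V) : v \notin [set a (inl u) | u : V1] -> exists u, v = a (inr u).
  rewrite -[v]aK'; case: (a' v) => u; last by exists u.
  by rewrite imset_f.
have sb (v : H) : v \notin [set b (inl u) | u : H1] -> exists u, v = b (inr u).
  rewrite -[v]bK'; case: (b' v) => u; last by exists u.
  by rewrite imset_f.
move=> h1 h2 h3 h4.
have /fin_all_exists[r1 r1P] i : exists u, z.1.2 (b (inl i)) = a (inl u).
  by have /imsetP[u _ ->] := h1 i; exists u.
have /fin_all_exists[r2 r2P] i : exists u, z.1.2 (b (inr i)) = a (inr u) by exact: sa.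
have /fin_all_exists[f1 f1P] i : exists u, z.2 (b (inl i)) = b (inl u).
  by have /imsetP[u _ ->] := h3 i; exists u.
have /fin_all_exists[f2 f2P] i : exists u, z.2 (b (inr i)) = b (inr u) by exact: sb.
exists (([ffun u => z.1.1 (a (inl u))], finfun r1, finfun f1),
        ([ffun u => z.1.1 (a (inr u))], finfun r2, finfun f2)).
case: z h1 h2 h3 h4 r1P r2P f1P f2P => [[g r] f] /= h1 h2 h3 h4 r1P r2P f1P f2P.
congr (_, _, _); apply/ffunP => v; rewrite ffunE.
- by rewrite -[in LHS](aK' v); case: (a' v) => u /=; rewrite ffunE.
- by rewrite -[in LHS](bK' v); case: (b' v) => u /=; rewrite ffunE.
- by rewrite -[in LHS](bK' v); case: (b' v) => u /=; rewrite ffunE.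
Qed.

End Glue.

Section Split.
Variables V H : finType.

Lemma set_split (T : finType) (B : {set T}) :
  exists (a : 'I_#|B| + 'I_#|~: B| -> T) (a' : T -> 'I_#|B| + 'I_#|~: B|),
  [/\ cancel a a', cancel a' a & [set a (inl u) | u : 'I_#|B|] = B].
Proof.
pose a (z : 'I_#|B| + 'I_#|~: B|) := match z with inl i => enum_val i | inr i => enum_val i end.
have aI : injective a.
  move=> [i|i] [j|j] /=.
  - by move/enum_val_inj->.
  - by move=> E; have := enum_valP i; have := enum_valP j; rewrite -E inE => /negbTE->.
  - by move=> E; have := enum_valP j; have := enum_valP i; rewrite E inE => /negbTE->.
  - by move/enum_val_inj->.
have [a' aK a'K] : bijective a.
  by apply: inj_card_bij => //; rewrite card_sum !card_ord cardsC.
exists a, a'; split=> //; apply/setP => t; apply/imsetP/idP => [[i _ ->]|tB].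
  exact: enum_valP.
by exists (enum_rank_in tB t) => //=; rewrite enum_rankK_in.
Qed.

(** Count pairs of a graph and one of its components. The statistic is additive
    over the vertices, hence over the components; removing the component with
    vertex set [B] and half-edge set [C] leaves an arbitrary graph. *)
Theorem labelled_split :
  \sum_(x : labelled V H | lvalid x) lweight x *+ lstat x =
  \sum_(B : {set V}) \sum_(C : {set H})
    (\sum_(x : labelled 'I_#|B| 'I_#|C| | lvalid x && lconn x) lweight x *+ lstat x) *
    (\sum_(x : labelled 'I_#|~: B| 'I_#|~: C| | lvalid x) lweight x).
Proof.
pose m (x : labelled V H) B := (\sum_(w | component_of x w == B) s (lgenus x w) (degree_at x.1.2 w))%N.
transitivity (\sum_(x : labelled V H | lvalid x) \sum_(B : {set V}) lweight x *+ m x B).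
  apply: eq_bigr => x _; rewrite sumrMnr; congr (_ *+ _).
  by rewrite /lstat (partition_big (component_of x) predT).
rewrite exchange_big; apply: eq_bigr => B _.
rewrite (partition_big (fun x : labelled V H => x.1.2 @^-1: B) predT) //=.
apply: eq_bigr => C _.
have [a [a' [aK a'K aB]]] := set_split B.
have [b [b' [bK b'K bC]]] := set_split C.
have aBE v : (v \in [set a (inl u) | u : 'I_#|B|]) = (v \in B) by rewrite aB.
have bCE v : (v \in [set b (inl u) | u : 'I_#|C|]) = (v \in C) by rewrite bC.
pose S := [set glue a a' b b' x | x in [pred x | lvalid x.1 && lvalid x.2]].
(* A set of vertices that is a component has its half-edges stable under the
   involution, so the graph is a disjoint union along it. *)
have inS x : lvalid x -> x.1.2 @^-1: B = C -> m x B != 0%N -> x \in S.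
  move=> I EC nz.
  have rC h : (x.1.2 h \in B) = (h \in C) by rewrite -EC inE.
  have [w cw] : exists w, component_of x w == B.
    apply/existsP; apply: contra_neqT nz; rewrite negb_exists => /forallP c.
    by rewrite /m big_pred0 // => w; apply/negbTE.
  have fC h : h \in C -> x.2 h \in C.
    rewrite -!rC -(eqP cw) !inE => c; apply: connect_trans c (connect1 _).
    by apply/existsP; exists h; rewrite !eqxx.
  have bl i : b (inl i) \in C by rewrite -bCE imset_f.
  have br i : b (inr i) \notin C.
    by rewrite -bCE; apply/imsetP => -[j _ /(can_inj bK)].
  have [|||| z zE] := @glue_onto _ _ _ _ _ _ a a' b b' a'K b'K x; rewrite ?aB ?bC.
  - by move=> i; rewrite rC bl.
  - by move=> i; rewrite rC br.
  - by move=> i; rewrite fC.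
  - move=> i; apply: contra (br i) => /fC; by rewrite (lvalidP _ I).
  by rewrite zE imset_f // inE -(glue_valid a a' bK b'K) -zE.
have Sin z : lvalid z.1 && lvalid z.2 ->
    lvalid (glue a a' b b' z) && ((glue a a' b b' z).1.2 @^-1: B == C).
  move=> I; rewrite (glue_valid a a' bK b'K) I /=; apply/eqP/setP => h.
  rewrite inE -[h]b'K -aBE -bCE; case: (b' h) => i; rewrite glueE //.
    by rewrite !imset_f.
  by apply/imsetP/imsetP => -[j _ E]; [have := can_inj aK E | have := can_inj bK E].
transitivity (\sum_(x in S) lweight x *+ m x B).
  rewrite [RHS]big_mkcond [LHS]big_mkcond; apply: eq_bigr => x _.
  have [xS|xS] := boolP (x \in S).
    by case/imsetP: xS => z zI ->; rewrite (Sin z zI).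
  case: ifP => // /andP[I /eqP E].
  have [->|nz] := eqVneq (m x B) 0%N; first by rewrite mulr0n.
  by rewrite inS in xS.
rewrite big_imset /=; last by move=> u v _ _; apply: glue_inj.
transitivity (\sum_(z : labelled 'I_#|B| 'I_#|C| * labelled 'I_#|~: B| 'I_#|~: C| | lvalid z.1 && lvalid z.2)
   (lweight z.1 *+ (if lconn z.1 then lstat z.1 else 0)) * lweight z.2).
  apply: eq_bigr => z /[dup] I /andP[I1 I2].
  rewrite (glue_weight aK a'K bK b'K) ?(glue_valid a a' bK b'K) // mulrnAl.
  congr (_ *+ _); rewrite -(glue_stat aK a'K bK b'K I1) /m.
  by apply: eq_bigl => w; rewrite aB.
rewrite big_distrlr /= pair_big /= big_mkcond [RHS]big_mkcond.
apply: eq_bigr => -[z1 z2] _ /=.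
by case: (lvalid z1); case: (lvalid z2); case: (lconn z1); rewrite ?mulr0n ?mul0r.
Qed.
End Split.

Lemma sum_set_card (T : finType) (F : nat -> A) :
  \sum_(B : {set T}) F #|B| = \sum_(i < #|T|.+1) F i *+ 'C(#|T|, i).
Proof.
rewrite (partition_big (fun B : {set T} => inord #|B| : 'I_#|T|.+1) predT) //=.
apply: eq_bigr => i _; rewrite -card_draws -sum1dep_card -sumrMnr.
have E (B : {set T}) : (inord #|B| == i :> 'I_#|T|.+1) = (#|B| == i :> nat).
  by rewrite -val_eqE /= inordK // ltnS max_card.
rewrite (eq_bigl _ _ E); apply: eq_bigr => B /eqP ->; by rewrite mulr1n.
Qed.

Definition all_sum n m : A := \sum_(x : labelled 'I_n 'I_m | lvalid x) lweight x.
Definition conn_sum n m : A := \sum_(x : labelled 'I_n 'I_m | lvalid x && lconn x) lweight x.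

Corollary all_sum_split n m :
  \sum_(x : labelled 'I_n 'I_m | lvalid x) lweight x *+ lstat x =
  \sum_(i < n.+1) \sum_(j < m.+1)
    ((\sum_(x : labelled 'I_i 'I_j | lvalid x && lconn x) lweight x *+ lstat x)
      * all_sum (n - i) (m - j)) *+ ('C(n, i) * 'C(m, j)).
Proof.
rewrite labelled_split.
pose G i j := (\sum_(x : labelled 'I_i 'I_j | lvalid x && lconn x) lweight x *+ lstat x)
      * all_sum (n - i) (m - j).
transitivity (\sum_(B : {set 'I_n}) \sum_(C : {set 'I_m}) G #|B| #|C|).
  apply: eq_bigr => B _; apply: eq_bigr => C _; rewrite /G.
  have cB (T : finType) (D : {set T}) k' : #|T| = k' -> (k' - #|D|)%N = #|~: D|.
    by move=> <-; rewrite -(cardsC D) addKn.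
  by rewrite !(cB _ _ _ (card_ord _)).
under eq_bigr => B _ do rewrite (sum_set_card _ (G #|B|)).
rewrite (sum_set_card _ (fun i => \sum_(j < #|'I_m|.+1) G i j *+ 'C(#|'I_m|, j))).
rewrite !card_ord; apply: eq_bigr => i _; rewrite -sumrMnl.
by apply: eq_bigr => j _; rewrite -mulrnA mulnC.
Qed.
End Lab.

(** * Derivations and formal power series *)
Section Derivation.
Variable A : comNzRingType.
Implicit Types d : A -> A.

Definition derivation d := {morph d : x z / x + z} /\ forall x z, d (x * z) = d x * z + x * d z.

Variable d : A -> A.
Hypothesis dd : derivation d.

Lemma derD : {morph d : x z / x + z}. Proof. by case: dd. Qed.
Lemma derM x z : d (x * z) = d x * z + x * d z. Proof. by case: dd. Qed.
Lemma der0 : d 0 = 0.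
Proof. by apply: (addrI (d 0)); rewrite -derD !addr0. Qed.
Lemma der1 : d 1 = 0.
Proof. by have := derM 1 1; rewrite !mulr1 mul1r => E; apply: (addrI (d 1)); rewrite addr0 -E. Qed.
Lemma derN x : d (- x) = - d x.
Proof. by apply: (addrI (d x)); rewrite -derD !subrr der0. Qed.
Lemma derMn x n : d (x *+ n) = d x *+ n.
Proof. by elim: n => [|n IH]; rewrite ?der0 // !mulrS derD IH. Qed.
Lemma derX x n : d (x ^+ n) = x ^+ n.-1 * d x *+ n.
Proof.
elim: n => [|n IH]; first by rewrite expr0 der1 mulr0n.
rewrite exprS derM IH; case: n {IH} => [|n]; first by rewrite mulr0n /=; ring.
by rewrite /= exprS mulrnAr; ring.
Qed.
Lemma der_sum I (r : seq I) P (F : I -> A) :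
  d (\sum_(i <- r | P i) F i) = \sum_(i <- r | P i) d (F i).
Proof. exact: (big_morph d derD der0). Qed.
Lemma der_prod (I : eqType) (r : seq I) (F : I -> A) : uniq r ->
  d (\prod_(i <- r) F i) =
  \sum_(j <- r) \prod_(i <- r) (if i == j then d (F i) else F i).
Proof.
elim: r => [|x r IH] /=; first by rewrite !big_nil der1.
case/andP=> xr /IH{}IH; rewrite !big_cons derM IH eqxx; congr (_ * _ + _).
  by apply: eq_big_seq => i ir; case: eqP => // E; rewrite -E ir in xr.
rewrite big_distrr /=; apply: eq_big_seq => j jr; rewrite big_cons.
by case: eqP => // E; rewrite -E (negbTE xr) in jr.
Qed.
End Derivation.

Section Fps.
Variable A : comNzRingType.
Implicit Types f g : fps A.

Lemma coefD_fps f g n : fpscoef (f + g) n = fpscoef f n + fpscoef g n.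
Proof. by []. Qed.
Lemma coefM_fps f g n : fpscoef (f * g) n = \sum_(i < n.+1) fpscoef f i * fpscoef g (n - i).
Proof. by []. Qed.
Lemma coefN_fps f n : fpscoef (- f) n = - fpscoef f n.
Proof. by []. Qed.
Lemma coef0_fps n : fpscoef (0 : fps A) n = 0.
Proof. by rewrite /= mul0rn. Qed.
Lemma coef1_fps n : fpscoef (1 : fps A) n = (n == 0%N)%:R.
Proof. by []. Qed.
Lemma coefMn_fps f k n : fpscoef (f *+ k) n = fpscoef f n *+ k.
Proof. by elim: k => [|k IH]; rewrite ?mulr0n ?coef0_fps // !mulrS coefD_fps IH. Qed.
Lemma coef_sum_fps I (r : seq I) P (F : I -> fps A) n :
  fpscoef (\sum_(i <- r | P i) F i) n = \sum_(i <- r | P i) fpscoef (F i) n.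
Proof. exact: (big_morph (fun f => fpscoef f n) (fun f g => coefD_fps f g n) (coef0_fps n)). Qed.
Lemma coefC_fps c f n : fpscoef (fpsconst c * f) n = c * fpscoef f n.
Proof.
rewrite coefM_fps big_ord_recl /= mulr1n subn0 big1 ?addr0 // => i _.
by rewrite mulr0n mul0r.
Qed.
Lemma coefX_fps f n : fpscoef (fpsvar * f) n = if n is n'.+1 then fpscoef f n' else 0.
Proof.
rewrite coefM_fps; case: n => [|n]; rewrite big_ord_recl /= mul0r add0r ?big_ord0 //.
rewrite big_ord_recl /= mul1r subSS subn0 big1 ?addr0 // => i _.
by rewrite mul0r.
Qed.

Lemma fpsderiv_derivation : derivation (@fpsderiv A).
Proof.
split=> [f g|f g]; apply: fpsP => n; first by rewrite /= mulrnDl.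
rewrite coefD_fps !coefM_fps /=.
have -> : (\sum_(i < n.+2) fpscoef f i * fpscoef g (n.+1 - i)) *+ n.+1 =
   \sum_(i < n.+2) (fpscoef f i *+ i) * fpscoef g (n.+1 - i)
  + \sum_(i < n.+2) fpscoef f i * (fpscoef g (n.+1 - i) *+ (n.+1 - i)).
  rewrite -sumrMnl -big_split; apply: eq_bigr => i _ /=.
  by rewrite mulrnAl mulrnAr -mulrnDr subnKC // -ltnS.
rewrite [in LHS]big_ord_recl /= mulr0n mul0r add0r; congr (_ + _).
rewrite big_ord_recr /= subnn mulr0n mulr0 addr0.
by apply: eq_bigr => i _; rewrite subSn // -ltnS.
Qed.

Definition fpsmap (d : A -> A) f := Fps (fun n => d (fpscoef f n)).
Lemma fpsmap_derivation d : derivation d -> derivation (fpsmap d).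
Proof.
move=> dd; split=> f g; apply: fpsP => n /=; first exact: derD.
rewrite der_sum // -big_split; apply: eq_bigr => i _ /=; exact: derM.
Qed.

Definition fpseuler f := Fps (fun n => fpscoef f n *+ n).
Lemma fpseuler_derivation : derivation fpseuler.
Proof.
split=> f g; apply: fpsP => n /=; first by rewrite mulrnDl.
rewrite -sumrMnl -big_split; apply: eq_bigr => i _ /=.
by rewrite mulrnAl mulrnAr -mulrnDr subnKC // -ltnS.
Qed.

Definition egf n f := fpscoef f n *+ n`!.

Lemma egfS n f : egf n.+1 f = egf n (fpsderiv f).
Proof. by rewrite /egf /= -mulrnA factS. Qed.

(** The product rule for exponential generating functions, by induction on the
    number of half-edges: the last half-edge goes to some vertex [v], where it
    differentiates the factor [U v], and the sum over [v] is the derivative of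
    the product. *)
Theorem sum_roots (V : finType) m (U : V -> fps A) :
  \sum_(r : {ffun 'I_m -> V}) \prod_v egf (degree_at r v) (U v) = egf m (\prod_v U v).
Proof.
elim: m U => [|m IH] U.
  have e0 f : egf 0 f = fpscoef f 0 by rewrite /egf mulr1n.
  rewrite e0 (big_morph (fun f => fpscoef f 0) (id1 := 1) (op1 := *%R)); first last.
  - by [].
  - by move=> f g; rewrite coefM_fps big_ord_recl big_ord0 addr0.
  rewrite (big_pred1 [ffun i => match notF (valP i) with end]).
    by apply: eq_bigr => v _; rewrite degree_atE big_ord0 e0.
  by move=> r; apply/esym/eqP/ffunP => -[].
pose E (z : V * {ffun 'I_m -> V}) : {ffun 'I_m.+1 -> V} :=
  [ffun i => if unlift ord0 i is Some j then z.2 j else z.1].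
pose E' (r : {ffun 'I_m.+1 -> V}) := (r ord0, [ffun j => r (lift ord0 j)]).
rewrite (reindex E) /=; last first.
  exists E' => [[v r] _|r _].
    congr (_, _); first by rewrite ffunE unlift_none.
    by apply/ffunP => j; rewrite !ffunE liftK.
  by apply/ffunP => i; rewrite ffunE; case: unliftP => [j|] -> //=; rewrite ffunE.
rewrite -(pair_bigA _ (fun (v : V) (r : {ffun 'I_m -> V}) => \prod_w egf (degree_at (E (v, r)) w) (U w))) /=.
rewrite egfS (der_prod fpsderiv_derivation) ?index_enum_uniq //.
rewrite /egf coef_sum_fps -sumrMnl; apply: eq_bigr => v _.
rewrite -/(egf _ _) -IH; apply: eq_bigr => r _; apply: eq_bigr => w _.
rewrite degree_atE big_ord_recl /= ffunE unlift_none /=.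
under eq_bigr => i _ do rewrite ffunE liftK /=.
rewrite -degree_atE eq_sym; case: eqP => [_|_] /=; rewrite ?add0n ?add1n.
  by rewrite -egfS.
by [].
Qed.
End Fps.

(** * Pairing half-edges *)
Section Hermite.
Variables (A : comNzRingType) (y k : A).

(** Two consecutive values, as the recursion has order two. *)
Fixpoint herm_pair n : A * A :=
  if n is m.+1 then let p := herm_pair m in (p.2, y * p.2 + k * p.1 *+ m.+1) else (1, y).
Definition herm n := (herm_pair n).1.

Lemma herm0 : herm 0 = 1. Proof. by []. Qed.
Lemma herm1 : herm 1 = y. Proof. by []. Qed.
Lemma hermS n : herm n.+2 = y * herm n.+1 + k * herm n *+ n.+1. Proof. by []. Qed.

(** [herm] is an Appell sequence for the variable [y]. *)
Lemma der_herm d n : derivation d -> d y = 1 -> d k = 0 -> d (herm n.+1) = herm n *+ n.+1.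
Proof.
move=> dd dy dk; elim/ltn_ind: n => -[|[|n]] IH; first by rewrite herm1 dy.
  by rewrite hermS !herm1 !herm0 (derD dd) (derMn dd) !(derM dd) dy dk (der1 dd); ring.
rewrite hermS (derD dd) (derMn dd) !(derM dd) dy dk !IH // [in RHS]hermS.
by rewrite [herm n.+2]hermS; ring.
Qed.

(** Adding a half-edge acts as the operator y + k d/dy. *)
Lemma herm_der d n : derivation d -> d y = 1 -> d k = 0 ->
  herm n.+1 = y * herm n + k * d (herm n).
Proof.
move=> dd dy dk; case: n => [|n]; first by rewrite herm1 herm0 (der1 dd); ring.
by rewrite (der_herm n dd dy dk) hermS; ring.
Qed.

Variable H : finType.
Implicit Types (f : {ffun H -> H}) (B : {set H}).

Definition invol_on B f := [forall h, f (f h) == h] && [forall h, (h \notin B) ==> (f h == h)].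
Definition fix_in B f := #|[set h in B | f h == h]|.

Lemma invol_onP B f : reflect (involutive f /\ forall h, h \notin B -> f h = h) (invol_on B f).
Proof.
apply: (iffP andP) => [[/forallP fK /forallP fB]|[fK fB]]; split.
- by move=> h; apply/eqP.
- by move=> h hB; apply/eqP; move/implyP: (fB h); apply.
- by apply/forallP => h; rewrite fK.
- by apply/forallP => h; apply/implyP => /fB/eqP.
Qed.

Lemma invol_card B f : invol_on B f -> #|B| = (fix_in B f + 2 * n_int f)%N.
Proof.
case/invol_onP => fK fB; have := card_halves fK; rewrite -(cardsC B).
have -> : n_ext f = (fix_in B f + #|~: B|)%N; last by lia.
rewrite /n_ext -(cardsID B [set h | f h == h]); congr (_ + _)%N; apply: eq_card => h.
  by rewrite !inE andbC.
by rewrite !inE; case: (boolP (h \in B)) => //= /fB ->; rewrite eqxx.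
Qed.

Definition invol_sum B := \sum_(f | invol_on B f) y ^+ fix_in B f * k ^+ n_int f.

Lemma invol_on_fix B a f : a \in B -> invol_on B f && (f a == a) = invol_on (B :\ a) f.
Proof.
move=> aB; apply/andP/invol_onP => [[/invol_onP[fK fB] /eqP fa]|[fK fB]].
  by split=> // h; rewrite !inE negb_and negbK => /orP[/eqP->|/fB].
split; last by rewrite fB // !inE eqxx.
by apply/invol_onP; split=> // h hB; apply: fB; rewrite !inE (negbTE hB) andbF.
Qed.

(** Either [a] is a fixed point, or it is exchanged with another element [j] of
    [B]; removing [a] or the pair leaves an involution of the rest. *)
Lemma invol_sum_step B a : a \in B ->
  invol_sum B = y * invol_sum (B :\ a) + \sum_(j in B :\ a) k * invol_sum (B :\ a :\ j).
Proof.
move=> aB; rewrite /invol_sum (partition_big (fun f : {ffun H -> H} => f a) predT) //=.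
rewrite (bigD1 a) //=; congr (_ + _).
  rewrite (eq_bigl _ _ (fun f => invol_on_fix f aB)) big_distrr; apply: eq_bigr => f If /=.
  have I : invol_on B f by move: If; rewrite -invol_on_fix // => /andP[].
  have := invol_card I; have := invol_card If; have := cardsD1 a B; rewrite aB /= => e1 e2 e3.
  have -> : fix_in B f = (fix_in (B :\ a) f).+1 by lia.
  by rewrite (exprS y (fix_in _ _)) mulrA.
rewrite big_mkcond [RHS]big_mkcond; apply: eq_bigr => j _; rewrite !inE.
case: eqP => //= /eqP ja; case: ifP => jB; last first.
  apply: big_pred0 => f; apply/negbTE/negP => /andP[/invol_onP[fK fB] /eqP E].
  have : f j = a by rewrite -E fK.
  by rewrite fB ?jB // => e; rewrite e eqxx in ja.
(* [sw] makes [a] and [j] exchange places, [us] undoes it. *)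
pose sw (f : {ffun H -> H}) : {ffun H -> H} := [ffun h => if h == a then j else if h == j then a else f h].
pose us (f : {ffun H -> H}) : {ffun H -> H} := [ffun h => if (h == a) || (h == j) then h else f h].
rewrite (reindex_onto sw us); last first.
  move=> f /andP[/invol_onP[fK fB] /eqP E]; apply/ffunP => h; rewrite !ffunE.
  case: eqP => [->//|] _; case: eqP => [->|//] /=; by rewrite -E fK.
rewrite big_distrr /=.
have dom f : invol_on B (sw f) && (sw f a == j) && (us (sw f) == f) = invol_on (B :\ a :\ j) f.
  apply/andP/invol_onP => [[/andP[/invol_onP[fK fB] _] /eqP E]|[fK fB]].
    have fo h : (h == a) || (h == j) -> f h = h by rewrite -E ffunE => ->.
    split=> [h|h].
      have [ho|ho] := boolP ((h == a) || (h == j)); first by rewrite !fo.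
      have := fK h; rewrite ffunE [sw f h]ffunE; move: ho; rewrite negb_or => /andP[/negbTE h1 /negbTE h2].
      rewrite h1 h2; case: eqP => [_ jh|_]; first by rewrite -jh eqxx in h2.
      by case: eqP => [_ jh|//]; rewrite -jh eqxx in h1.
    rewrite !inE !negb_and !negbK => /orP[hj|/orP[ha|hB]]; try by rewrite fo ?ha ?hj ?orbT.
    have [ho|ho] := boolP ((h == a) || (h == j)); first by rewrite fo.
    move: ho; rewrite negb_or => /andP[/negbTE h1 /negbTE h2].
    by have := fB h hB; rewrite ffunE h1 h2.
  have fa : f a = a by apply: fB; rewrite !inE eqxx andbF.
  have fj : f j = j by apply: fB; rewrite !inE eqxx.
  have fna h : h != a -> f h != a by rewrite -{2}fa (inj_eq (can_inj fK)).
  have fnj h : h != j -> f h != j by rewrite -{2}fj (inj_eq (can_inj fK)).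
  split; last first.
    by apply/eqP/ffunP => h; rewrite !ffunE; case: eqP => [->|/eqP h1] //=; case: eqP => [->|/eqP h2].
  rewrite ffunE eqxx eqxx andbT; apply/invol_onP; split=> h.
    rewrite !ffunE; case: (eqVneq h a) => [->|h1]; first by rewrite (negbTE ja) eqxx.
    case: (eqVneq h j) => [->|h2]; first by rewrite eqxx.
    by rewrite (negbTE (fna _ h1)) (negbTE (fnj _ h2)) fK.
  move=> hB; rewrite ffunE; case: (eqVneq h a) => [E|h1]; first by rewrite -E (negbTE hB) in aB.
  case: (eqVneq h j) => [E|h2]; first by rewrite -E (negbTE hB) in jB.
  by apply: fB; rewrite !inE (negbTE hB) !andbF.
rewrite (eq_bigl _ _ dom); apply: eq_bigr => f If.
have I : invol_on B (sw f) by move: If; rewrite -dom => /andP[/andP[]].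
have E : fix_in B (sw f) = fix_in (B :\ a :\ j) f.
  apply: eq_card => h; rewrite !inE ffunE.
  case: (eqVneq h a) => [->|h1] /=; first by rewrite (negbTE ja) !andbF.
  case: (eqVneq h j) => [->|h2] //=; by rewrite eq_sym (negbTE ja) andbF.
have := invol_card I; have := invol_card If; have := cardsD1 a B; have := cardsD1 j (B :\ a).
rewrite aB !inE ja jB E /= => e1 e2 e3 e4.
have -> : n_int (sw f) = (n_int f).+1 by lia.
by rewrite (exprS k (n_int f)) mulrCA.
Qed.

Theorem invol_sumE B : invol_sum B = herm #|B|.
Proof.
have [n] := ubnP #|B|; elim: n B => // n IH B; rewrite ltnS => lB.
have [->|[a aB]] := set_0Vmem B.
  rewrite cards0 herm0 /invol_sum (big_pred1 [ffun h => h]) => [|f].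
    have /invol_card : invol_on set0 [ffun h => h].
      by apply/invol_onP; split=> h; rewrite !ffunE.
    rewrite cards0 => /esym/eqP; rewrite addn_eq0 muln_eq0 /= => /andP[/eqP-> /eqP->].
    by rewrite !expr0 mulr1.
  apply/invol_onP/eqP => [[_ fB]|->]; last by split=> h; rewrite !ffunE.
  by apply/ffunP => h; rewrite ffunE fB ?inE.
have cB := cardsD1 a B; rewrite aB /= in cB.
rewrite (invol_sum_step aB) IH; last by lia.
rewrite (eq_bigr (fun=> k * herm #|B|.-2)); last first.
  move=> j jB; rewrite IH; last by have := cardsD1 j (B :\ a); lia.
  by have := cardsD1 j (B :\ a); rewrite jB cB => ->.
rewrite sumr_const cB; case: #|B :\ a| => [|m]; first by rewrite mulr0n herm1 herm0; ring.
by rewrite hermS.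
Qed.
End Hermite.

(** * Euler characteristics of the vertices *)

(** The negative of the Euler characteristic of a surface of genus [g] with [n]
    punctures, truncated at 0; it is positive exactly for stable types. *)
Definition neg_euler g n := (2 * g + n - 2)%N.
(** Extending by zero to unstable types lets sums over all graphs select the
    stable ones. *)
Definition stable_chi g n : rat := if (2 < 2 * g + n)%N then chiM g n else 0.

Lemma chiM03 : chiM 0 3 = 1.
Proof. by rewrite /chiM /bernoulli /= big_ord0 /=; apply/eqP; rewrite -[_ == _]/true. Qed.

Lemma chiMS g n : (2 < 2 * g + n)%N -> chiM g n.+1 = - (chiM g n *+ neg_euler g n).
Proof.
move=> st; rewrite /chiM /neg_euler.
have -> : (2 * g + n.+1 - 3 = (2 * g + n - 3).+1)%N by lia.
have -> : (2 * g + n - 2 = (2 * g + n - 3).+1)%N by lia.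
by rewrite factS natrM exprS -[in RHS]mulr_natl; ring.
Qed.

(** Forgetting a marked point multiplies by the Euler characteristic of the
    punctured surface. The types (0,3) and (1,1), which become unstable, are the
    two corrections. *)
Lemma stable_chiS g n : stable_chi g n.+1 =
  - (stable_chi g n *+ neg_euler g n) + ((g == 0%N) && (n == 2))%:R + chiM 1 1 *+ ((g == 1%N) && (n == 0%N)).
Proof.
rewrite /stable_chi; case: ifP => st.
  case: ifP => st'.
    have -> : (g == 0%N) && (n == 2) = false by lia.
    have -> : (g == 1%N) && (n == 0%N) = false by lia.
    by rewrite chiMS // mulr0n !addr0.
  case: g st st' => [|[|g]] st st'; last by lia.
    have -> : n = 2 by lia.
    by rewrite chiM03 mul0rn oppr0 add0r mulr0n addr0.
  have -> : n = 0%N by lia.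
  by rewrite mul0rn oppr0 !add0r.
have -> : (g == 0%N) && (n == 2) = false by lia.
have -> : (g == 1%N) && (n == 0%N) = false by lia.
have -> : (2 < 2 * g + n)%N = false by lia.
by rewrite mul0rn oppr0 !addr0.
Qed.

(** The outer variable is y and the inner one kappa. *)
Notation RR := {poly {poly rat}}.
Definition const_RR : {rmorphism rat -> RR} := (polyC \o polyC : rat -> RR).
Definition lift_RR : {rmorphism {poly rat} -> {poly RR}} := map_poly const_RR.

(** The variable is t. *)
Definition vertex_mono g n : {poly rat} := (stable_chi g n)%:P * 'X^(neg_euler g n).
Definition vertex_weight g n : {poly RR} := lift_RR (vertex_mono g n).
Notation yR := ('X : RR).
Notation kR := ('X%:P : RR).

(** * Generating functions of labelled graphs *)
Section LabCoef.
Variable N : nat.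
Variables V H : finType.
Implicit Types x : labelled N V H.
Notation lstx := (lstat neg_euler).

Definition lcoef x : RR :=
  const_RR (\prod_v stable_chi (lgenus x v) (degree_at x.1.2 v)) * edge_part yR kR x.2.

Lemma lweight_coef x : lweight vertex_weight yR%:P kR%:P x = (lcoef x)%:P * 'X^(lstx x).
Proof.
rewrite /lweight /lcoef /edge_part polyCM !rmorphM !rmorphXn /= mulrAC; congr (_ * _).
rewrite /vertex_part /lstat -prodrXr !rmorph_prod -big_split /=; apply: eq_bigr => v _.
by rewrite /vertex_weight /vertex_mono /lift_RR rmorphM /= map_polyXn map_polyC.
Qed.

Lemma sum_degree_at (r : H -> V) : (\sum_v degree_at r v = #|H|)%N.
Proof.
under eq_bigr => v _ do rewrite degree_atE.
rewrite exchange_big /= -sum1_card; apply: eq_bigr => h _.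
by rewrite (bigD1 (r h)) //= eqxx big1 // => v /negbTE; rewrite eq_sym => ->.
Qed.

Lemma lcoef_stable x v : lcoef x != 0 -> (2 < 2 * lgenus x v + degree_at x.1.2 v)%N.
Proof.
apply: contraNT => us; rewrite /lcoef (bigD1 v) //= /stable_chi (negbTE us).
by rewrite mul0r rmorph0 mul0r.
Qed.

(** A stable vertex has 2g - 2 + n >= 1 and n <= 3 (2g - 2 + n), so only finitely
    many graphs contribute to each power of t. *)
Lemma lstat_bound x : (forall v, 2 < 2 * lgenus x v + degree_at x.1.2 v)%N ->
  (#|V| <= lstx x)%N && (#|H| <= 3 * lstx x)%N.
Proof.
move=> st; rewrite -(sum_degree_at x.1.2) -sum1_card /lstat big_distrr /=.
by apply/andP; split; apply: leq_sum => v _; have := st v; rewrite /neg_euler;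
  move: (lgenus x v) (degree_at _ v) => a b; lia.
Qed.
End LabCoef.

Section Z.
Variable N : nat.
Hypothesis N2 : (1 < N)%N.

Notation ZL := (all_sum N vertex_weight yR%:P kR%:P).
Notation CL := (conn_sum N vertex_weight yR%:P kR%:P).

(** The exponential generating function, in the valence, of a single vertex. *)
Definition vertex_egf : fps {poly rat} :=
  Fps (fun n => (n`!%:R^-1)%:P * \sum_(g < N) vertex_mono g n).

Lemma egf_vertex_egf n : egf n vertex_egf = \sum_(g < N) vertex_mono g n.
Proof.
rewrite /egf /= -mulrnAl -polyCMn -[_ *+ n`!]mulr_natl divff ?mul1r //.
by rewrite pnatr_eq0 -lt0n fact_gt0.
Qed.

Lemma herm_polyC m : herm (yR%:P : {poly RR}) kR%:P m = (herm yR kR m)%:P.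
Proof.
elim/ltn_ind: m => -[|[|m]] IH //.
by rewrite !hermS !IH // polyCD polyCMn !polyCM.
Qed.

(** The involution is independent of the vertices and of the attachment of the
    half-edges, so the sum over all graphs is a product. *)
Lemma all_sum_factor k m : ZL k m = lift_RR (egf m (vertex_egf ^+ k)) * (herm yR kR m)%:P.
Proof.
transitivity ((\sum_(g : {ffun 'I_k -> 'I_N}) \sum_(r : {ffun 'I_m -> 'I_k})
    \prod_v vertex_weight (g v) (degree_at r v)) *
    \sum_(f : {ffun 'I_m -> 'I_m} | invol_on [set: 'I_m] f) edge_part yR%:P kR%:P f).
  rewrite pair_big big_distrl /=.
  under [RHS]eq_bigr => p _ do rewrite big_distrr /=.
  rewrite pair_big /=; apply: eq_bigl => -[[g r] f].
  rewrite /lvalid /invol_on /=; apply/esym/andb_idr => _.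
  by apply/forallP => h; rewrite inE.
congr (_ * _).
  rewrite exchange_big /= -[k in vertex_egf ^+ k]card_ord -prodr_const.
  rewrite -sum_roots rmorph_sum; apply: eq_bigr => r _.
  rewrite rmorph_prod /=; under [RHS]eq_bigr => v _ do rewrite egf_vertex_egf rmorph_sum /=.
  by rewrite bigA_distr_bigA.
rewrite -herm_polyC -[m in herm _ _ m]card_ord -cardsT -invol_sumE.
apply: eq_bigr => f _; congr (_ ^+ _ * _); apply: eq_card => h.
by rewrite !inE.
Qed.

Definition euler_op (p : {poly rat}) := 'X * p^`().
Lemma euler_op_derivation : derivation euler_op.
Proof. by split=> p q; rewrite /euler_op ?derivD ?derivM; ring. Qed.
Lemma coef_euler_op p n : (euler_op p)`_n = p`_n *+ n.
Proof. by rewrite /euler_op coefXM coef_deriv; case: n. Qed.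

Lemma vertex_monoS g n : vertex_mono g n.+1 = 'X * (((g == 0%N) && (n == 2))%:R
  + (chiM 1 1)%:P *+ ((g == 1%N) && (n == 0%N)) - euler_op (vertex_mono g n)).
Proof.
have E : euler_op (vertex_mono g n) = vertex_mono g n *+ neg_euler g n.
  apply/polyP => i; rewrite coef_euler_op coefMn /vertex_mono coefCM coefXn.
  by case: eqP => [->|_] //; rewrite mulr0 !mul0rn.
rewrite E {E} /vertex_mono stable_chiS.
have [st|ns] := ltnP 2 (2 * g + n).
  have -> : (g == 0%N) && (n == 2) = false by lia.
  have -> : (g == 1%N) && (n == 0%N) = false by lia.
  have -> : neg_euler g n.+1 = (neg_euler g n).+1 by rewrite /neg_euler; lia.
  by rewrite !mulr0n !addr0 polyCN polyCMn exprS; ring.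
have -> : stable_chi g n = 0 by rewrite /stable_chi ltnNge ns.
rewrite polyC0 mul0r !mul0rn !oppr0 add0r addr0.
case: (boolP ((g == 0%N) && (n == 2))) => [/andP[/eqP-> /eqP->]|_].
  by rewrite /= !mulr0n !addr0 mul1r mulr1.
case: (boolP ((g == 1%N) && (n == 0%N))) => [/andP[/eqP-> /eqP->]|_].
  by rewrite /= !mulr1n !add0r mulrC.
by rewrite !addr0 mulr0 mul0r.
Qed.

(** The vertices of type (0,3) and (1,1) without the forgotten half-edge. *)
Definition special_vertices : fps {poly rat} := fpsconst (2^-1)%:P * fpsvar ^+ 2 + fpsconst (chiM 1 1)%:P.

(** [stable_chiS] as a differential equation. *)
Lemma vertex_egf_eq : fpsderiv vertex_egf = fpsconst 'X * (special_vertices - fpsmap euler_op vertex_egf).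
Proof.
have dd := euler_op_derivation.
apply: fpsP => n; rewrite coefC_fps coefD_fps coefN_fps /special_vertices coefD_fps coefC_fps.
rewrite expr2 coefX_fps /=.
have -> : (match n with 0 => 0 | n'.+1 => (n' == 1%N)%:R end : {poly rat}) = (n == 2)%:R.
  by case: n => [|[|n]].
rewrite (derM dd) {1}/euler_op derivC mulr0 mul0r add0r (der_sum dd).
rewrite -mulrnAl -polyCMn.
have -> : n.+1`!%:R^-1 *+ n.+1 = n`!%:R^-1 :> rat.
  rewrite factS natrM invfM -[LHS]mulr_natl mulrA divff ?mul1r //.
  by rewrite pnatr_eq0.
under eq_bigr => g _ do rewrite vertex_monoS.
rewrite -big_distrr sumrB big_split /= mulrCA; congr (_ * _); rewrite mulrBr; congr (_ - _).
rewrite (bigD1 (Ordinal (ltnW N2))) //= big1 ?addr0; last by move=> i; rewrite -val_eqE /= => /negbTE->.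
rewrite (bigD1 (Ordinal N2)) //= big1 ?addr0; last by move=> i; rewrite -val_eqE /= => /negbTE->.
case: n => [|[|[|n]]] /=; rewrite ?mulr0n ?mulr1n ?mulr0 ?addr0 ?add0r ?mulr0 ?mulr1 //.
by rewrite mul1r.
Qed.

Lemma vertex_egfX_eq k : fpsderiv (vertex_egf ^+ k) =
  fpsconst 'X * (special_vertices * vertex_egf ^+ k.-1 *+ k - fpsmap euler_op (vertex_egf ^+ k)).
Proof.
rewrite (derX (fpsderiv_derivation _)) (derX (fpsmap_derivation euler_op_derivation)) vertex_egf_eq.
by ring.
Qed.

(** The coefficient of t^D for [k] vertices and [m] half-edges without names. *)
Definition vertex_coef k m D : rat := (fpscoef (vertex_egf ^+ k) m)`_D / k`!%:R.

Lemma vertex_coef_rec k m D : vertex_coef k m.+1 D.+1 *+ m.+1 =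
  (if k is k'.+1 then 
     (if m is m'.+2 then vertex_coef k' m' D / 2 else 0) + chiM 1 1 * vertex_coef k' m D else 0)
  - vertex_coef k m D *+ D.
Proof.
have := congr1 (fun f : fps {poly rat} => (fpscoef f m)`_D.+1) (vertex_egfX_eq k).
rewrite coefC_fps coefXM /= coefMn coefB coef_euler_op => E.
rewrite /vertex_coef -mulrnAl {}E mulrBl mulrnAl; congr (_ - _).
case: k => [|k]; first by rewrite mulr0n coef0_fps coef0 mul0r.
rewrite coefMn_fps /special_vertices mulrDl -mulrA coefD_fps !coefC_fps coefMn coefD !coefCM [k.+1.-1]/=.
rewrite expr2 -mulrA !coefX_fps factS natrM -[_ *+ k.+1]mulr_natr.
have n0 : k.+1%:R != 0 :> rat by rewrite pnatr_eq0.
have f0 : k`!%:R != 0 :> rat by rewrite pnatr_eq0 -lt0n fact_gt0.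
move: (k.+1%:R) (k`!%:R) n0 f0 => x z n0 f0.
by case: m => [|[|m]]; rewrite ?coefX_fps ?coef0; field; rewrite n0 f0.
Qed.

(** Multiplying by this constant forgets the names of [k] vertices and [m]
    half-edges. *)
Definition inv_facts k m : RR := const_RR (k`!%:R * m`!%:R)^-1.
Definition all_coef k m D : RR := inv_facts k m * (ZL k m)`_D.
Definition conn_coef k m D : RR := inv_facts k m * (CL k m)`_D.

Definition small_support (a : nat -> nat -> nat -> RR) :=
  forall k m D, (3 * D < k)%N || (3 * D < m)%N -> a k m D = 0.
Definition total (a : nat -> nat -> nat -> RR) : fps RR :=
  Fps (fun D => \sum_(k < (3 * D).+1) \sum_(m < (3 * D).+1) a k m D).

Lemma sum_ord_widen (F : nat -> RR) n n' : (n <= n')%N ->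
  (forall i, (n <= i)%N -> F i = 0) -> \sum_(i < n') F i = \sum_(i < n) F i.
Proof.
move=> le F0; rewrite -(subnKC le) big_split_ord /= [X in _ + X]big1 ?addr0 // => i _.
by rewrite F0 // leq_addr.
Qed.

Lemma coef_tot a D K M : small_support a -> (3 * D < K)%N -> (3 * D < M)%N ->
  fpscoef (total a) D = \sum_(k < K) \sum_(m < M) a k m D.
Proof.
move=> sa lK lM /=; apply/esym.
rewrite (@sum_ord_widen (fun k => \sum_(m < M) a k m D) (3 * D).+1) //; last first.
  by move=> i li; rewrite big1 // => m _; rewrite sa // li.
apply: eq_bigr => k _; apply: (sum_ord_widen (F := fun m => a k m D)) => // i li.
by rewrite sa // li orbT.
Qed.

Lemma coef_all_sum k m D : (ZL k m)`_D =
  \sum_(x : labelled N 'I_k 'I_m | lvalid x && (lstat neg_euler x == D)) lcoef x.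
Proof.
rewrite /all_sum coef_sum big_mkcondr; apply: eq_bigr => x _; rewrite lweight_coef coefCM coefXn.
by rewrite eq_sym; case: eqP; rewrite ?mulr1 ?mulr0.
Qed.
Lemma coef_conn_sum k m D : (CL k m)`_D =
  \sum_(x : labelled N 'I_k 'I_m | lvalid x && lconn x && (lstat neg_euler x == D)) lcoef x.
Proof.
rewrite /conn_sum coef_sum [RHS]big_mkcondr; apply: eq_bigr => x _; rewrite lweight_coef coefCM coefXn.
by rewrite eq_sym; case: eqP; rewrite ?mulr1 ?mulr0.
Qed.

Lemma small_lcoef k m D (P : pred (labelled N 'I_k 'I_m)) : (3 * D < k)%N || (3 * D < m)%N ->
  \sum_(x : labelled N 'I_k 'I_m | P x && (lstat neg_euler x == D)) lcoef x = 0.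
Proof.
move=> l; apply: big1 => x /andP[_ /eqP E]; apply/eqP; apply/negPn/negP => nz.
have := lstat_bound (fun v => lcoef_stable v nz).
by rewrite !card_ord E; lia.
Qed.
Lemma small_all_coef : small_support all_coef.
Proof. by move=> k m D l; rewrite /all_coef coef_all_sum small_lcoef ?mulr0. Qed.
Lemma small_conn_coef : small_support conn_coef.
Proof. by move=> k m D l; rewrite /conn_coef coef_conn_sum small_lcoef ?mulr0. Qed.

Lemma all_coefE k m D : all_coef k m D = const_RR (vertex_coef k m D) * herm yR kR m.
Proof.
rewrite /all_coef all_sum_factor coefMC coef_map mulrA -rmorphM; congr (const_RR _ * _).
rewrite /vertex_coef /egf coefMn -[_ *+ m`!]mulr_natl.
have f0 : k`!%:R != 0 :> rat by rewrite pnatr_eq0 -lt0n fact_gt0.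
have g0 : m`!%:R != 0 :> rat by rewrite pnatr_eq0 -lt0n fact_gt0.
by field; rewrite f0 g0.
Qed.

(** Vanishing for [K <= i + j] makes the triangle cut out by [i + j < K] as good as
    the square. *)
Lemma sum_conv (G : nat -> nat -> RR) K : (forall i j, (K <= i + j)%N -> G i j = 0) ->
  \sum_(k < K) \sum_(i < k.+1) G i (k - i)%N = \sum_(i < K) \sum_(j < K) G i j.
Proof.
move=> G0.
transitivity (\sum_(k < K) \sum_(i < K) (if (i <= k)%N then G i (k - i)%N else 0)).
  apply: eq_bigr => k _; rewrite -big_mkcond.
  rewrite (big_ord_widen K (fun i => G i (k - i)%N)) //.
rewrite exchange_big /=; apply: eq_bigr => i _.
rewrite -(big_mkord xpredT (fun k => if (i <= k)%N then G i (k - i)%N else 0)).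
rewrite (@big_cat_nat _ _ _ i) //=; last exact: ltnW.
rewrite big_nat big1 ?add0r => [|k /andP[_ ki]]; last by rewrite leqNgt ki.
rewrite -{1}[nat_of_ord i]add0n big_addn big_mkord.
rewrite [RHS](@sum_ord_widen (G i) (K - i)%N) ?leq_subr //.
  by apply: eq_bigr => k _; rewrite leq_addl addnK.
by move=> k; rewrite leq_subLR => /G0.
Qed.

Lemma sum_conv2 (G : nat -> nat -> nat -> nat -> RR) K :
  (forall i j i' j', (K <= i + i')%N || (K <= j + j')%N -> G i j i' j' = 0) ->
  \sum_(k < K) \sum_(m < K) \sum_(i < k.+1) \sum_(j < m.+1) G i j (k - i)%N (m - j)%N =
  \sum_(i < K) \sum_(j < K) \sum_(i' < K) \sum_(j' < K) G i j i' j'.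
Proof.
move=> G0.
transitivity (\sum_(k < K) \sum_(i < k.+1) \sum_(j < K) \sum_(j' < K) G i j (k - i)%N j').
  apply: eq_bigr => k _; rewrite exchange_big; apply: eq_bigr => i _ /=.
  by apply: (sum_conv (G := fun j j' => G i j (k - i)%N j')) => j j' l; rewrite G0 // l orbT.
rewrite (sum_conv (G := fun i i' => \sum_(j < K) \sum_(j' < K) G i j i' j')) => [|i i' l].
  by apply: eq_bigr => i _; rewrite exchange_big.
by rewrite big1 // => j _; rewrite big1 // => j' _; rewrite G0 // l.
Qed.

Definition all_gf := total all_coef.
Definition conn_gf := total conn_coef.

Lemma all_coef_split k m D : all_coef k m D *+ D =
  \sum_(i < k.+1) \sum_(j < m.+1) \sum_(E < D.+1) (conn_coef i j E *+ E) * all_coef (k - i) (m - j) (D - E).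
Proof.
have mark n p (P : pred (labelled N 'I_n 'I_p)) E :
    (\sum_(x | P x) lweight vertex_weight yR%:P kR%:P x *+ lstat neg_euler x)`_E =
    (\sum_(x | P x) lweight vertex_weight yR%:P kR%:P x)`_E *+ E.
  rewrite !coef_sum -sumrMnl; apply: eq_bigr => x _.
  rewrite coefMn lweight_coef coefCM coefXn; case: eqP => [->//|_].
  by rewrite mulr0 !mul0rn.
rewrite /all_coef -mulrnAr -mark all_sum_split coef_sum big_distrr; apply: eq_bigr => i _ /=.
rewrite coef_sum big_distrr; apply: eq_bigr => j _ /=.
rewrite coefMn coefM -sumrMnl big_distrr; apply: eq_bigr => E _ /=.
rewrite mark -/(conn_sum _ _ _ _ _ _) /conn_coef /all_coef.
have fE : inv_facts k m *+ ('C(k, i) * 'C(m, j)) = inv_facts i j * inv_facts (k - i) (m - j).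
  rewrite /inv_facts -[LHS]rmorphMn -[RHS]rmorphM. congr (const_RR _).
  have ik : (i <= k)%N by rewrite -ltnS.
  have jm : (j <= m)%N by rewrite -ltnS.
  rewrite -(bin_fact ik) -(bin_fact jm) !natrM -[_ *+ _]mulr_natl natrM.
  have nz n : n`!%:R != 0 :> rat by rewrite pnatr_eq0 -lt0n fact_gt0.
  have bz n p : (p <= n)%N -> 'C(n, p)%:R != 0 :> rat by rewrite pnatr_eq0 -lt0n bin_gt0.
  by field; rewrite !nz !bz.
rewrite mulrnAr -mulrnAl fE -!mulrnAr; ring.
Qed.

Lemma coef_all_gf D K M : (3 * D < K)%N -> (3 * D < M)%N ->
  fpscoef all_gf D = \sum_(k < K) \sum_(m < M) all_coef k m D.
Proof. by apply: coef_tot; apply: small_all_coef. Qed.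
Lemma coef_conn_gf D K M : (3 * D < K)%N -> (3 * D < M)%N ->
  fpscoef conn_gf D = \sum_(k < K) \sum_(m < M) conn_coef k m D.
Proof. by apply: coef_tot; apply: small_conn_coef. Qed.

(** The exponential formula, in differential form. *)
Theorem euler_all_gf : fpseuler all_gf = fpseuler conn_gf * all_gf.
Proof.
apply: fpsP => D; rewrite coefM_fps [LHS]/=.
rewrite -sumrMnl.
transitivity (\sum_(k < (3 * D).+1) \sum_(m < (3 * D).+1) \sum_(i < k.+1) \sum_(j < m.+1)
   \sum_(E < D.+1) (conn_coef i j E *+ E) * all_coef (k - i) (m - j) (D - E)).
  apply: eq_bigr => k _; rewrite -sumrMnl; apply: eq_bigr => m _; exact: all_coef_split.
rewrite (sum_conv2 (G := fun i j i' j' =>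
    \sum_(E < D.+1) (conn_coef i j E *+ E) * all_coef i' j' (D - E))); last first.
  move=> i j i' j' l; apply: big1 => E _; have lE : (E <= D)%N by rewrite -ltnS.
  have [l1|/norP[l1 l2]] := boolP ((3 * E < i)%N || (3 * E < j)%N).
    by rewrite small_conn_coef ?mul0rn ?mul0r.
  by rewrite small_all_coef ?mulr0 //; move: (nat_of_ord E) lE l1 l2 l; lia.
under eq_bigr => i _ do under eq_bigr => j _ do under eq_bigr => i' _ do rewrite exchange_big.
under eq_bigr => i _ do under eq_bigr => j _ do rewrite exchange_big.
under eq_bigr => i _ do rewrite exchange_big.
rewrite exchange_big; apply: eq_bigr => E _ /=.
have lE : (E <= D)%N by rewrite -ltnS.
rewrite -[RHS]/((fpscoef conn_gf E *+ E) * fpscoef all_gf (D - E)).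
rewrite (@coef_conn_gf E (3 * D).+1 (3 * D).+1) ?(@coef_all_gf (D - E) (3 * D).+1 (3 * D).+1); try by lia.
rewrite -sumrMnl big_distrl; apply: eq_bigr => i _ /=.
rewrite -sumrMnl big_distrl; apply: eq_bigr => j _ /=.
by rewrite big_distrr; apply: eq_bigr => i' _ /=; rewrite big_distrr.
Qed.

Notation dy := (fpsmap (@deriv [the nzRingType of {poly rat}])).
Lemma deriv_derivation : derivation (@deriv [the nzRingType of {poly rat}] : RR -> RR).
Proof. by split=> p q; rewrite ?derivD ?derivM. Qed.

Lemma coef_all_gf0 : fpscoef all_gf 0 = 1.
Proof.
rewrite (@coef_all_gf 0 1 1) // !big_ord1 all_coefE /vertex_coef expr0 coef1_fps coef1.
by rewrite divr1 rmorph1 mul1r herm0.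
Qed.
Lemma coef_conn_gf0 : fpscoef conn_gf 0 = 0.
Proof.
rewrite (@coef_conn_gf 0 1 1) // !big_ord1 /conn_coef /conn_sum big_pred0 ?coef0 ?mulr0 // => x.
by rewrite /lconn /graph_conn card_ord andbF.
Qed.

Lemma mulrnI_RR (p : RR) n : (0 < n)%N -> p *+ n = 0 -> p = 0.
Proof.
move=> n0; rewrite -mulr_natl => /eqP; rewrite mulf_eq0 => /orP[|/eqP//].
by rewrite -(rmorph_nat const_RR) /= !polyC_eq0 pnatr_eq0 eqn0Ngt n0.
Qed.

(** Both Z and F carry the commuting derivations t d/dt and d/dy. The defect
    G = dZ/dy - (dF/dy) Z satisfies t dG/dt = (t dF/dt) G; as F has no constant term
    in t and G vanishes at t = 0, each coefficient of G is zero in turn. *)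
Lemma der_all_gf : dy all_gf = dy conn_gf * all_gf.
Proof.
have de := fpsmap_derivation deriv_derivation.
have eu := fpseuler_derivation RR.
have comm f : fpseuler (dy f) = dy (fpseuler f).
  by apply: fpsP => n /=; rewrite derivMn.
pose G := dy all_gf - dy conn_gf * all_gf.
suff: G = 0 by move/eqP; rewrite subr_eq0 => /eqP.
have EG : fpseuler G = fpseuler conn_gf * G.
  rewrite /G (derD eu) (derN eu) (derM eu) !comm euler_all_gf !(derM de).
  by ring.
apply: fpsP => n; rewrite coef0_fps; elim/ltn_ind: n => -[|n] IH.
  have dyE f n : fpscoef (dy f) n = (fpscoef f n)^`() by [].
  rewrite /G coefD_fps coefN_fps coefM_fps big_ord1 !dyE coef_all_gf0 [nat_of_ord _]/= coef_conn_gf0.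
  by rewrite deriv0 derivC mul0r subr0.
apply: (@mulrnI_RR _ n.+1) => //.
rewrite -[_ *+ _]/(fpscoef (fpseuler G) n.+1) EG coefM_fps.
rewrite big1 // => -[[|i] li] _; first by rewrite [X in X * _]mulr0n mul0r.
by rewrite IH ?mulr0 //=; lia.
Qed.

(** The operator (y + kappa d/dy)^2, expanded. It accounts for the two half-edges that
    remain when a vertex of type (0,3) is forgotten. *)
Definition wick (p : RR) := yR ^+ 2 * p + yR * kR * p^`() *+ 2 + kR * p + kR ^+ 2 * p^`()^`().

Lemma herm_wick m : herm yR kR m.+2 = wick (herm yR kR m).
Proof.
have dy1 : deriv yR = 1 by rewrite derivX.
have dk : deriv kR = 0 by rewrite derivC.
have hd n : herm yR kR n.+1 = yR * herm yR kR n + kR * (herm yR kR n)^`().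
  exact: (herm_der n deriv_derivation dy1 dk).
by rewrite !hd !derivE /wick; ring.
Qed.

Lemma wick_sum (I : Type) (r : seq I) (F : I -> RR) :
  wick (\sum_(i <- r) F i) = \sum_(i <- r) wick (F i).
Proof. by rewrite /wick !(der_sum deriv_derivation) !big_distrr -sumrMnl -!big_split. Qed.

(** Differentiating in y removes an external half-edge, since [herm] is an Appell
    sequence; [vertex_coef_rec] then describes the vertex it was attached to. *)
Lemma linear_all_gf D : (fpscoef all_gf D.+1)^`() =
  const_RR 2^-1 * wick (fpscoef all_gf D) + const_RR (chiM 1 1) * fpscoef all_gf D - fpscoef all_gf D *+ D.
Proof.
pose K := (3 * D + 4)%N.
have derQQ q : (const_RR q)^`() = 0 by exact: derivC.
rewrite (@coef_all_gf D.+1 K K.+1) ?(@coef_all_gf D K K); try by rewrite /K; lia.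
transitivity (\sum_(k < K) \sum_(m < K) const_RR (vertex_coef k m.+1 D.+1 *+ m.+1) * herm yR kR m).
  rewrite (der_sum deriv_derivation); apply: eq_bigr => k _.
  rewrite (der_sum deriv_derivation) big_ord_recl all_coefE derivM herm0 derQQ derivC mulr0 mul0r !add0r.
  apply: eq_bigr => m _; rewrite all_coefE derivM derQQ mul0r add0r lift0.
  by rewrite (der_herm m deriv_derivation) ?derivX ?derivC // raddfMn /= mulrnAr mulrnAl.
(* The contributions of the vertices of type (0,3) and (1,1). *)
pose T k m :=
  const_RR (if k is k'.+1 then if m is m'.+2 then vertex_coef k' m' D else 0 else 0) * herm yR kR m.
pose T' k m := const_RR (if k is k'.+1 then vertex_coef k' m D else 0) * herm yR kR m.
transitivity (\sum_(k < K) \sum_(m < K)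
   (const_RR 2^-1 * T k m + const_RR (chiM 1 1) * T' k m - all_coef k m D *+ D)).
  apply: eq_bigr => k _; apply: eq_bigr => m _.
  rewrite vertex_coef_rec all_coefE rmorphB rmorphMn mulrBl mulrnAl; congr (_ - _).
  rewrite /T /T' !mulrA -!rmorphM -mulrDl -rmorphD; congr (const_RR _ * _).
  case: (nat_of_ord k) => [|k']; first by rewrite !mulr0 addr0.
  by case: (nat_of_ord m) => [|[|m']]; rewrite ?mulr0 // mulrC.
under eq_bigr => k _ do rewrite sumrB big_split -!big_distrr /=.
rewrite sumrB big_split -!big_distrr /=; congr (_ * _ + _ * _ - _); last first.
- by rewrite -sumrMnl; apply: eq_bigr => k _; rewrite sumrMnl.
- rewrite -(coef_all_gf (K := K) (M := K)) ?(@coef_all_gf D (3 * D).+3 K); try by rewrite /K; lia.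
  have -> : K = (3 * D).+4 by rewrite /K; lia.
  rewrite big_ord_recl big1 ?add0r => [|m _]; last by rewrite /T' rmorph0 mul0r.
  apply: eq_bigr => k _; apply: eq_bigr => m _.
  by rewrite /T' lift0 all_coefE.
- rewrite -(coef_all_gf (K := K) (M := K)) ?(@coef_all_gf D (3 * D).+3 (3 * D).+2); try by rewrite /K; lia.
  have -> : K = (3 * D).+4 by rewrite /K; lia.
  rewrite big_ord_recl big1 ?add0r => [|m _]; last by rewrite /T rmorph0 mul0r.
  rewrite wick_sum; apply: eq_bigr => k _; rewrite [LHS]big_ord_recl [X in _ + X]big_ord_recl.
  rewrite /T !lift0 !rmorph0 !mul0r !add0r.
  rewrite wick_sum; apply: eq_bigr => m _; rewrite !lift0 all_coefE herm_wick /wick !derivM.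
  have -> : (const_RR (vertex_coef k m D))^`() = 0 by exact: derivC.
  by rewrite !mul0r !add0r !derivM (derivC _ : (const_RR _)^`() = 0); ring.
Qed.

Lemma fps_regular (f g : fps RR) : fpscoef f 0 = 1 -> f * g = 0 -> g = 0.
Proof.
move=> f0 fg; apply: fpsP => n; rewrite coef0_fps; elim/ltn_ind: n => n IH.
have := congr1 (fun h : fps RR => fpscoef h n) fg; rewrite coef0_fps coefM_fps.
rewrite big_ord_recl subn0 f0 mul1r big1 ?addr0 // => i _; rewrite lift0 IH ?mulr0 //.
by case: i => i /= li; lia.
Qed.

(** The linear equation divided by Z: the second derivative of an exponential
    produces the square of dF/dy. *)
Theorem quadratic_conn_gf : dy conn_gf = fpsvar * (fpsconst (const_RR 2^-1) *
    (fpsconst yR ^+ 2 + fpsconst yR * fpsconst kR * dy conn_gf *+ 2 + fpsconst kR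
      + fpsconst kR ^+ 2 * (dy (dy conn_gf) + dy conn_gf ^+ 2)) + fpsconst (const_RR (chiM 1 1)) - fpseuler conn_gf).
Proof.
have de := fpsmap_derivation deriv_derivation.
have lin : dy all_gf = fpsvar * (fpsconst (const_RR 2^-1) *
    (fpsconst yR ^+ 2 * all_gf + fpsconst yR * fpsconst kR * dy all_gf *+ 2 + fpsconst kR * all_gf
      + fpsconst kR ^+ 2 * dy (dy all_gf)) + fpsconst (const_RR (chiM 1 1)) * all_gf - fpseuler all_gf).
  apply: fpsP => -[|D]; rewrite coefX_fps.
    by rewrite -[LHS]/((fpscoef all_gf 0)^`()) coef_all_gf0 derivC.
  rewrite -[LHS]/((fpscoef all_gf D.+1)^`()) linear_all_gf coefD_fps coefN_fps coefD_fps !coefC_fps.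
  congr (_ * _ + _ - _); rewrite /wick !expr2 -!mulrA !coefD_fps.
  rewrite !coefC_fps.
  by [].
apply/eqP; rewrite -subr_eq0; apply/eqP.
apply: (fps_regular coef_all_gf0).
have d2 : dy (dy all_gf) = (dy (dy conn_gf) + dy conn_gf ^+ 2) * all_gf.
  by rewrite der_all_gf (derM de) der_all_gf; ring.
move: lin; rewrite d2 der_all_gf euler_all_gf => lin; rewrite mulrBr.
apply/eqP; rewrite subr_eq0 mulrC lin; apply/eqP; ring.
Qed.

End Z.

(** * The genus of a connected graph *)

(** Polynomials also have a [root]. *)
Notation hroot := Defs.root.

Section Genus.
Variable G : stable_graph.
Hypothesis cG : connected_graph G.

Lemma external_n_ext : #|external_edges G| = n_ext (@flip G). Proof. by []. Qed.
Lemma internal_n_int : #|internal_edges G| = n_int (@flip G). Proof. by []. Qed.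

(** Each internal edge has exactly one half that comes before its opposite. *)
Lemma card_oriented : #|[set h : 'I_(nh G) | (h < flip h)%N]| = n_int (@flip G).
Proof.
have := card_halves (@flipK G); rewrite -cardsT.
rewrite -(cardsID [set h : 'I_(nh G) | flip h == h] [set: 'I_(nh G)]) setTI -/(n_ext _).
rewrite -(cardsID [set h : 'I_(nh G) | (h < flip h)%N] (_ :\: _)).
have -> : #|([set: 'I_(nh G)] :\: [set h | flip h == h]) :&: [set h : 'I_(nh G) | (h < flip h)%N]| =
    #|[set h : 'I_(nh G) | (h < flip h)%N]|.
  apply: eq_card => h; rewrite !inE andbT; case: eqP => // ->; by rewrite ltnn.
have -> : #|([set: 'I_(nh G)] :\: [set h | flip h == h]) :\: [set h : 'I_(nh G) | (h < flip h)%N]| =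
    #|[set h : 'I_(nh G) | (h < flip h)%N]|.
  rewrite -(card_imset _ (can_inj (@flipK G))); apply: eq_card => h.
  rewrite !inE andbT; apply/andP/imsetP => [[h1 h2]|[i]].
    exists (flip h); rewrite ?flipK // inE flipK ltn_neqAle.
    by rewrite (leqNgt (flip h)) h1 andbT; apply: contra h2 => /eqP/val_inj->.
  rewrite inE => li ->; rewrite flipK -leqNgt (ltnW li); split=> //.
  by apply/eqP => E; rewrite -E ltnn in li.
by lia.
Qed.

Lemma coboundaryE v h : coboundary G v h = (hroot (flip h) == v)%:R - (hroot h == v)%:R.
Proof. by rewrite mxE. Qed.

(** Opposite half-edges have opposite columns, and external ones have zero columns,
    so the matrix factors through the space spanned by the internal edges. Without
    this bound the truncated subtraction in [h1] could lose information. *)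
Lemma rank_coboundary_le : (\rank (coboundary G) <= n_int (@flip G))%N.
Proof.
rewrite -card_oriented; set S := [set h : 'I_(nh G) | (h < flip h)%N].
pose M1 : 'M[rat]_(nv G, #|S|) := \matrix_(v, i) coboundary G v (enum_val i).
pose M2 : 'M[rat]_(#|S|, nh G) :=
  \matrix_(i, h) ((enum_val i == h)%:R - (enum_val i == flip h)%:R).
suff -> : coboundary G = M1 *m M2 by apply: mulmx_max_rank.
apply/matrixP => v h; rewrite [RHS]mxE.
transitivity (\sum_(s in S) coboundary G v s * ((s == h)%:R - (s == flip h)%:R)); last first.
  by rewrite big_enum_val; apply: eq_bigr => i _; rewrite !mxE.
under eq_bigr => s _ do rewrite mulrBr.
rewrite sumrB.
have pick j : \sum_(s in S) coboundary G v s * (s == j)%:R = coboundary G v j *+ (j \in S).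
  case: (boolP (j \in S)) => jS.
    rewrite (bigD1 j) //= eqxx mulr1 big1 ?addr0 // => s /andP[_ /negbTE->].
    by rewrite mulr0.
  by apply: big1 => s sS; case: eqP => [E|]; rewrite ?mulr0 //; rewrite -E sS in jS.
rewrite !pick !inE flipK !coboundaryE flipK.
case: (ltngtP h (flip h)) => [_|_|E].
- by rewrite mulr1n mulr0n subr0.
- by rewrite mulr1n mulr0n sub0r opprB.
- by rewrite -(val_inj E) !subrr.
Qed.

(** On a connected graph the kernel consists of the constant functions. *)
Lemma rank_coboundary : \rank (coboundary G) = (nv G).-1.
Proof.
have /andP[nv0 /forallP conn] := cG.
have := mxrank_ker (coboundary G).
have -> : \rank (kermx (coboundary G)) = 1%N; last first.
  by have := rank_leq_row (coboundary G); lia.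
have const u : u *m coboundary G = 0 -> forall v w, u ord0 v = u ord0 w :> rat.
  move=> /matrixP K; have step h : u ord0 (hroot (flip h)) = u ord0 (hroot h).
    have := K ord0 h; rewrite !mxE.
    under eq_bigr => v _ do rewrite coboundaryE mulrBr.
    rewrite sumrB (bigD1 (hroot (flip h))) //= eqxx mulr1 big1 => [|v /negbTE]; last first.
      by rewrite eq_sym => ->; rewrite mulr0.
    rewrite (bigD1 (hroot h)) //= eqxx mulr1 big1 => [|v /negbTE]; last first.
      by rewrite eq_sym => ->; rewrite mulr0.
    by rewrite !addr0 => /eqP; rewrite subr_eq0 => /eqP.
  move=> v w; have /forallP/(_ w)/connectP[p] := conn v.
  elim: p v => [|z p IH] v /=; first by move=> _ ->.
  by case/andP => /existsP[h /andP[/eqP <- /eqP <-]] /IH{}IH /IH <-; rewrite step.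
pose one : 'rV[rat]_(nv G) := const_mx 1.
have r1 : \rank one = 1%N.
  rewrite rank_rV; case: eqP => // /matrixP/(_ ord0 (Ordinal nv0)).
  by rewrite !mxE => /eqP; rewrite oner_eq0.
rewrite -[RHS]r1; apply/eqP; rewrite eqn_leq; apply/andP; split; apply: mxrankS.
  apply/row_subP => i; have := mulmx_ker (coboundary G) => /(congr1 (row i)).
  rewrite row_mul row0 => /const c; apply/sub_rVP; exists (row i (kermx (coboundary G)) ord0 (Ordinal nv0)).
  by apply/rowP => v; rewrite !mxE mulr1; have := c v (Ordinal nv0); rewrite !mxE.
apply/sub_kermxP/rowP => h; rewrite !mxE.
under eq_bigr => v _ do rewrite mxE coboundaryE mul1r.
rewrite sumrB (bigD1 (hroot (flip h))) //= eqxx big1 => [|v /negbTE]; last first.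
  by rewrite eq_sym => ->.
rewrite (bigD1 (hroot h)) //= eqxx big1 ?subrr // => v /negbTE.
by rewrite eq_sym => ->.
Qed.

Lemma genus_connected : (2 * graph_genus G + n_ext (@flip G) =
  \sum_v neg_euler (vgenus v) (degree_at (@hroot G) v) + 2)%N.
Proof.
have := rank_coboundary; have := rank_coboundary_le.
have /andP[nv0 _] := cG.
have := card_halves (@flipK G); rewrite card_ord.
have : (\sum_v neg_euler (vgenus v) (degree_at (@hroot G) v) + 2 * nv G = 2 * \sum_v @vgenus G v + nh G)%N.
  have := sum_degree_at (@hroot G); rewrite card_ord => s1.
  have s2 : (2 * nv G = \sum_(v < nv G) 2)%N by rewrite sum_nat_const card_ord mulnC.
  rewrite -[X in (_ + X)%N = _]/(2 * nv G)%N s2 -[X in (_ = _ + X)%N]s1 big_distrr -!big_split /=.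
  apply: eq_bigr => v _.
  have : (2 < 2 * vgenus v + degree_at (@hroot G) v)%N := stability v.
  by rewrite /neg_euler; move: (vgenus v) (degree_at _ v) => a b; lia.
move=> sD cH leE rk; rewrite /graph_genus /h1 internal_n_int.
have arith a b e x r n h : (a + 2 * n = 2 * b + h -> h = x + 2 * e -> r <= e ->
  r = n.-1 -> 0 < n -> 2 * (e - r + b) + x = a + 2)%N by lia.
exact: arith sD cH leE rk nv0.
Qed.
End Genus.

(** * Isomorphism classes and labelled graphs *)
Section Relabel.
Variables (N : nat) (V H : finType).
Implicit Types (x : labelled N V H) (p : {perm V} * {perm H}).

Definition relabel x p : labelled N V H :=
  ([ffun v => x.1.1 (p.1^-1%g v)], [ffun h => p.1 (x.1.2 (p.2^-1%g h))],
   [ffun h => p.2 (x.2 (p.2^-1%g h))]).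

Lemma relabel_g x p v : (relabel x p).1.1 (p.1 v) = x.1.1 v.
Proof. by rewrite ffunE permK. Qed.
Lemma relabel_r x p h : (relabel x p).1.2 (p.2 h) = p.1 (x.1.2 h).
Proof. by rewrite ffunE permK. Qed.
Lemma relabel_f x p h : (relabel x p).2 (p.2 h) = p.2 (x.2 h).
Proof. by rewrite ffunE permK. Qed.
Definition relabelE := (relabel_g, relabel_r, relabel_f).

Lemma relabelP x (z : labelled N V H) p : (forall v, z.1.1 (p.1 v) = x.1.1 v) ->
  (forall h, z.1.2 (p.2 h) = p.1 (x.1.2 h)) ->
  (forall h, z.2 (p.2 h) = p.2 (x.2 h)) -> z = relabel x p.
Proof.
case: z => [[g r] f] /= zg zr zf; congr (_, _, _); apply/ffunP => i; rewrite ffunE.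
- by rewrite -zg permKV.
- by rewrite -zr permKV.
- by rewrite -zf permKV.
Qed.

Lemma relabel1 x : relabel x 1%g = x.
Proof. by apply/esym/relabelP => i /=; rewrite !perm1. Qed.
Lemma relabelM x : act_morph relabel x.
Proof.
move=> p q; have e1 v : (p * q)%g.1 v = q.1 (p.1 v) := permM _ _ _.
have e2 h : (p * q)%g.2 h = q.2 (p.2 h) := permM _ _ _.
by apply/esym/relabelP => i; rewrite ?e1 e2 !relabelE || rewrite e1 !relabelE.
Qed.
Definition relabel_action := TotalAction relabel1 relabelM.

Lemma relabel_degree_at x p v : degree_at (relabel x p).1.2 (p.1 v) = degree_at x.1.2 v.
Proof.
rewrite !degree_atE (reindex_inj (@perm_inj _ p.2)) /=.
by apply: eq_bigr => h _; rewrite relabel_r (inj_eq perm_inj).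
Qed.

Lemma relabel_big (R : Type) (idx : R) (op : Monoid.com_law idx) (F : nat -> nat -> R) x p :
  \big[op/idx]_v F (lgenus (relabel x p) v) (degree_at (relabel x p).1.2 v) =
  \big[op/idx]_v F (lgenus x v) (degree_at x.1.2 v).
Proof.
rewrite (reindex_inj (@perm_inj _ p.1)) /=.
by apply: eq_bigr => v _; rewrite relabel_degree_at /lgenus relabel_g.
Qed.

Lemma relabel_inv x p : lvalid x -> lvalid (relabel x p).
Proof.
move/lvalidP => fK; apply/forallP => h; rewrite -[h](permKV p.2) !relabel_f fK //.
Qed.

Lemma relabel_ext x p : n_ext (relabel x p).2 = n_ext x.2.
Proof.
rewrite !n_extE (reindex_inj (@perm_inj _ p.2)) /=.
by apply: eq_bigr => h _; rewrite relabel_f (inj_eq perm_inj).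
Qed.

Lemma relabel_int x p : lvalid x -> n_int (relabel x p).2 = n_int x.2.
Proof.
move=> I; have := card_halves (lvalidP _ I).
have := card_halves (lvalidP _ (relabel_inv p I)); rewrite relabel_ext.
by move: (n_ext _) (n_int _) (n_int _) => a b c; lia.
Qed.

Lemma relabel_conn x p : lconn x -> lconn (relabel x p).
Proof.
case/andP=> n0 /forallP c; apply/andP; split=> //.
apply/forallP => v; apply/forallP => w.
rewrite -[v](permKV p.1) -[w](permKV p.1).
move: (p.1^-1%g v) (p.1^-1%g w) => {}v {}w.
have /forallP/(_ w)/connectP[q] := c v.
elim: q v => [|z q IH] v /=; first by move=> _ ->.
case/andP => /existsP[h /andP[/eqP <- /eqP <-]] /IH{}IH /IH; apply: connect_trans.
by apply: connect1; apply/existsP; exists (p.2 h); rewrite !relabelE !eqxx.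
Qed.

Definition lstab x := [forall v, 2 < 2 * lgenus x v + degree_at x.1.2 v]%N.

Lemma relabel_stab x p : lstab x -> lstab (relabel x p).
Proof.
move/forallP => st; apply/forallP => v; rewrite -[v](permKV p.1) relabel_degree_at /lgenus relabel_g.
exact: st.
Qed.

Definition lgood D n x := [&& lvalid x, lstab x, lconn x, lstat neg_euler x == D & n_ext x.2 == n].

Lemma relabel_good D n x p : lgood D n x -> lgood D n (relabel x p).
Proof.
case/and5P=> I st c d e; apply/and5P; split; rewrite ?relabel_ext //.
- exact: relabel_inv.
- exact: relabel_stab.
- exact: relabel_conn.
- by rewrite /lstat (relabel_big _ neg_euler).
Qed.

Lemma card_relabel_orbit x :
  (#|orbit relabel_action [set: _] x| * #|'C_[set: _][x | relabel_action]%g| = (#|V|)`! * (#|H|)`!)%N.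
Proof.
have cp (T : finType) : #|{perm T}| = (#|T|)`!.
  rewrite -(cardsT T) -card_perm; apply: eq_card => s.
  by rewrite !inE; apply/esym/fintype.subsetP => v _; rewrite inE.
by rewrite card_orbit_stab cardsT card_prod !cp.
Qed.

End Relabel.

Section Classes.
Variable N : nat.

(** The empty graph is the value of [to_stable_graph] at unstable data. *)
Fact empty_flipK : involutive (@id 'I_0). Proof. by []. Qed.
Fact empty_stab (v : 'I_0) : (2 < 2 * 0 + valence_of (@id 'I_0) v)%N. Proof. by case: v. Qed.
Definition empty_graph := @StableGraph 0 0 (fun=> 0%N) id id empty_flipK empty_stab.

Section Fixed.
Variables k m : nat.
Implicit Types x : labelled N 'I_k 'I_m.

Definition stable_labelled x := lvalid x && lstab x.
Lemma stable_labelled_flipK x : stable_labelled x -> involutive x.2.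
Proof. by case/andP => /lvalidP. Qed.
Lemma stable_labelled_stab x : stable_labelled x -> forall v, (2 < 2 * lgenus x v + valence_of x.1.2 v)%N.
Proof. by case/andP => _ /forallP. Qed.

Definition to_stable_graph x : stable_graph :=
  if stable_labelled x =P true is ReflectT xP then
    StableGraph (stable_labelled_flipK xP) (stable_labelled_stab xP)
  else empty_graph.

Lemma to_stable_graphE x : lvalid x -> lstab x -> exists Iv St,
  to_stable_graph x = @StableGraph k m (lgenus x) x.1.2 x.2 Iv St.
Proof.
move=> Iv St; rewrite /to_stable_graph; case: eqP => [xP|[]]; last by rewrite /stable_labelled Iv St.
by exists (stable_labelled_flipK xP), (stable_labelled_stab xP).
Qed.

Lemma to_stable_graph_conn x : lvalid x -> lstab x -> connected_graph (to_stable_graph x) = lconn x.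
Proof.
move=> Iv St; have [Iv' [St' ->]] := to_stable_graphE Iv St.
by rewrite /lconn /graph_conn card_ord.
Qed.

Lemma to_stable_graph_ext x : lvalid x -> lstab x -> #|external_edges (to_stable_graph x)| = n_ext x.2.
Proof. by move=> Iv St; have [Iv' [St' ->]] := to_stable_graphE Iv St. Qed.

Lemma to_stable_graph_genus x : lvalid x -> lstab x -> lconn x ->
  (2 * graph_genus (to_stable_graph x) + n_ext x.2 = lstat neg_euler x + 2)%N.
Proof.
move=> Iv St c; have := c; rewrite -(to_stable_graph_conn Iv St) => /genus_connected.
by have [Iv' [St' ->]] := to_stable_graphE Iv St.
Qed.

Definition stabilizer x := 'C_[set: {perm 'I_k} * {perm 'I_m}][x | relabel_action _ _ _]%g.

Lemma stabilizerE x s : (s \in stabilizer x) = (relabel x s == x).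
Proof.
rewrite /stabilizer finset.in_setI finset.in_setT /=.
apply/idP/eqP => [/(astab1P (to := relabel_action N _ _)) //|E]; exact/(astab1P (to := relabel_action N _ _)).
Qed.

Lemma to_stable_graph_weight x : lvalid x -> lstab x ->
  weight (to_stable_graph x) =
  (\prod_v stable_chi (lgenus x v) (degree_at x.1.2 v) / #|stabilizer x|%:R) *: 'X^(n_int x.2).
Proof.
move=> Iv St; have [Iv' [St' ->]] := to_stable_graphE Iv St.
rewrite /weight /=; congr ((_ / _%:R) *: _).
  apply: eq_bigr => v _; rewrite /stable_chi; by move/forallP: St => /(_ v) ->.
apply: eq_card => s; rewrite stabilizerE !inE /=; apply/andP/eqP.
  case=> /forallP vg /forallP rf; apply/esym/relabelP => i.
  - by apply/val_inj/eqP/vg.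
  - by apply/eqP; have /andP[] := rf i.
  - by apply/eqP; have /andP[] := rf i.
move=> /= E; split; apply/forallP => i; rewrite /lgenus -{1}E ?relabelE //.
by rewrite -{3}E relabelE !eqxx.
Qed.

End Fixed.

Lemma of_stable_graph (G : stable_graph) : (forall v, @vgenus G v < N)%N ->
  exists x : labelled N 'I_(nv G) 'I_(nh G), [/\ lvalid x, lstab x & to_stable_graph x = G].
Proof.
case: G => k m vg rt fl flK st /= vN.
pose x : labelled N 'I_k 'I_m := ([ffun v => Ordinal (vN v)], finfun rt, finfun fl).
have Eg : lgenus x = vg by apply/funext => v; rewrite /lgenus ffunE.
have Er : (x.1.2 : 'I_m -> 'I_k) = rt by apply/funext => v; rewrite ffunE.
have Ef : (x.2 : 'I_m -> 'I_m) = fl by apply/funext => v; rewrite ffunE.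
have Iv : lvalid x by apply/lvalidP; rewrite Ef.
have St : lstab x by apply/forallP => v; rewrite Eg Er; apply: st.
exists x; split=> //; have [Iv' [St' ->]] := to_stable_graphE Iv St.
move: Iv' St'; rewrite Eg Er Ef => Iv' St'.
by rewrite (Prop_irrelevance Iv' flK) (Prop_irrelevance St' st).
Qed.

Lemma to_stable_graph_iso k m k' m' (x : labelled N 'I_k 'I_m) (z : labelled N 'I_k' 'I_m') :
  lvalid x -> lstab x -> lvalid z -> lstab z ->
  isomorphic (to_stable_graph x) (to_stable_graph z) -> (k = k') /\ (m = m').
Proof.
move=> Iv St I1 S1; have [Iv' [St' ->]] := to_stable_graphE Iv St.
have [I1' [S1' ->]] := to_stable_graphE I1 S1.
case=> a [b [ba vertex_coef _ _ _]] /=; split.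
  by rewrite -[k]card_ord -[k']card_ord; apply: bij_eq_card ba.
by rewrite -[m]card_ord -[m']card_ord; apply: bij_eq_card vertex_coef.
Qed.

(** Isomorphisms between graphs on the same vertices and half-edges are
    relabellings. *)
Lemma iso_orbit k m (x z : labelled N 'I_k 'I_m) : lvalid x -> lstab x -> lvalid z -> lstab z ->
  isomorphic (to_stable_graph x) (to_stable_graph z) <-> z \in orbit (relabel_action N _ _) [set: _]%SET x.
Proof.
move=> Iv St I1 S1; have [Iv' [St' ->]] := to_stable_graphE Iv St.
have [I1' [S1' ->]] := to_stable_graphE I1 S1.
split.
  case=> a [b [ba vertex_coef /= ga ra fb]].
  apply/orbitP; exists (perm (bij_inj ba), perm (bij_inj vertex_coef)); first by rewrite inE.
  apply/esym/relabelP => i; rewrite !permE.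
  - by apply: val_inj; apply: ga.
  - exact: ra.
  - exact: fb.
case/orbitP => p _ /= E.
exists p.1, p.2; split=> /=.
- by exists (p.1^-1%g); [apply: permK | apply: permKV].
- by exists (p.2^-1%g); [apply: permK | apply: permKV].
- by move=> v; rewrite /lgenus -E relabel_g.
- by move=> h; rewrite -E relabel_r.
- by move=> h; rewrite -E relabel_f.
Qed.

Definition class_of k m (x : labelled N 'I_k 'I_m) : iso_class := (\pi_iso_class (to_stable_graph x))%qT.

Definition lterm k m (x : labelled N 'I_k 'I_m) : {poly rat} :=
  (\prod_v stable_chi (lgenus x v) (degree_at x.1.2 v) / (k`!%:R * m`!%:R)) *: 'X^(n_int x.2).

Lemma class_eqP (G G' : stable_graph) :
  reflect (isomorphic G G') (\pi_iso_class G == \pi_iso_class G')%qT.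
Proof. by rewrite eqmodE; apply: asboolP. Qed.

Lemma lgood_stable D n k m (x : labelled N 'I_k 'I_m) : lgood D n x -> lvalid x /\ lstab x.
Proof. by case/and5P. Qed.

(** The class of [x0] contains k! m! / |Aut| labelled graphs. *)
Lemma orbit_sum D n k m (x0 : labelled N 'I_k 'I_m) : lgood D n x0 ->
  \sum_(x : labelled N 'I_k 'I_m | lgood D n x && (class_of x == class_of x0)) lterm x =
  weight (to_stable_graph x0).
Proof.
move=> g0; have [I0 S0] := lgood_stable g0.
pose O := orbit (relabel_action N 'I_k 'I_m) [set: _]%SET x0.
have EO x : lgood D n x && (class_of x == class_of x0) = (x \in O).
  apply/andP/idP => [[/lgood_stable[I1 S1] /eqP/esym/eqP/class_eqP]|].
    by move/(iso_orbit I0 S0 I1 S1).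
  move=> xO; have gx : lgood D n x by case/orbitP: (xO) => p _ <-; apply: relabel_good.
  have [I1 S1] := lgood_stable gx; split=> //; rewrite eq_sym; apply/class_eqP.
  by apply/iso_orbit.
rewrite (eq_bigl _ _ EO) (eq_bigr (fun=> lterm x0)) => [|x /orbitP[p _ <-]]; last first.
  by rewrite /lterm /= (relabel_int p I0) (relabel_big _ stable_chi).
rewrite sumr_const (to_stable_graph_weight I0 S0) /lterm scalerMnl; congr (_ *: _).
have := card_relabel_orbit x0; rewrite -/(stabilizer x0) -/O !card_ord => E.
have st0 : #|stabilizer x0|%:R != 0 :> rat.
  rewrite pnatr_eq0; apply/eqP => E0; move: E; rewrite E0 muln0 => /esym/eqP.
  by rewrite muln_eq0 !(gtn_eqF (fact_gt0 _)).
have o0 : #|O|%:R != 0 :> rat.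
  by rewrite pnatr_eq0 -lt0n; apply/card_gt0P; exists x0; apply: orbit_refl.
rewrite -natrM -E natrM -[_ *+ _]mulr_natr; field; by rewrite st0 o0.
Qed.

Section Sum.
Variables g n D : nat.
Hypotheses (gN : (g < N)%N) (gD : (D + 2 = 2 * g + n)%N).
Let K := (3 * D).+1.

Definition classes : seq iso_class :=
  undup (flatten [seq flatten [seq [seq class_of x | x <- enum (@lgood N 'I_k 'I_m D n)]
    | m <- iota 0 K] | k <- iota 0 K]).

Lemma mem_classes C : reflect (exists k m (x : labelled N 'I_k 'I_m),
  [/\ (k < K)%N, (m < K)%N, lgood D n x & C = class_of x]) (C \in classes).
Proof.
rewrite mem_undup; apply: (iffP flatten_mapP) => [[k]|[k [m [x [kK mK gx ->]]]]].
  rewrite mem_iota leq0n add0n => kK /flatten_mapP[m].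
  rewrite mem_iota leq0n add0n => mK.
  by case/mapP => x; rewrite mem_enum => gx ->; exists k, m, x.
exists k; rewrite ?mem_iota //; apply/flatten_mapP; exists m; rewrite ?mem_iota //.
by apply/mapP; exists x; rewrite // mem_enum.
Qed.

Lemma lgood_bound k m (x : labelled N 'I_k 'I_m) : lgood D n x -> (k < K)%N && (m < K)%N.
Proof.
case/and5P => _ /forallP st _ /eqP sD _.
by have := lstat_bound st; rewrite !card_ord sD /K; lia.
Qed.

Lemma connected_classesE : connected_iso_classes g n = [set` classes]%classic.
Proof.
apply/seteqP; split=> C /=.
  case=> G [cG eg en] <-.
  have vN v : (@vgenus G v < N)%N.
    apply: leq_ltn_trans gN; rewrite -eg /graph_genus (bigD1 v) //=; lia.
  have [x [I1 S1 xG]] := of_stable_graph vN.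
  have gx : lgood D n x.
    have cx : lconn x by rewrite -(to_stable_graph_conn I1 S1) xG.
    have ex : n_ext x.2 = n by rewrite -(to_stable_graph_ext I1 S1) xG.
    have := to_stable_graph_genus I1 S1 cx; rewrite xG eg ex => E.
    by apply/and5P; split=> //; apply/eqP => //; lia.
  have /andP[kK mK] := lgood_bound gx.
  by apply/mem_classes; exists (nv G), (nh G), x; split=> //; rewrite /class_of xG.
case/mem_classes => k [m [x [_ _ gx ->]]]; exists (to_stable_graph x) => //.
case/and5P: gx => I1 S1 c1 /eqP sD /eqP en.
split; rewrite ?to_stable_graph_conn ?to_stable_graph_ext //.
by have := to_stable_graph_genus I1 S1 c1; rewrite sD en; lia.
Qed.

(** The chosen representative of a class has some number of vertices and half-edges,
    and only labelled graphs with the same numbers lie in the class. *)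
Lemma class_sum C : C \in classes ->
  \sum_(k < K) \sum_(m < K) \sum_(x : labelled N 'I_k 'I_m | lgood D n x && (class_of x == C)) lterm x
  = weight (repr C).
Proof.
case/mem_classes => k [m [x [kK mK gx EC]]].
have [I1 S1] := lgood_stable gx.
have iso : isomorphic (to_stable_graph x) (repr C) by apply/class_eqP; rewrite reprK EC.
have vN v : (@vgenus (repr C) v < N)%N.
  case: iso => a [b [[a' aK a'K] _ ga _ _]]; rewrite -[v]a'K ga; move: (a' v).
  by have [I' [S' ->]] := to_stable_graphE I1 S1 => /= u; rewrite /lgenus ltn_ord.
have [z [Iz Sz zC]] := of_stable_graph vN; rewrite -zC.
have {}iso : isomorphic (to_stable_graph x) (to_stable_graph z) by rewrite zC.
clear vN; move: (nv (repr C)) (nh (repr C)) z Iz Sz zC iso => k' m' z Iz Sz zC iso.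
have [Ek Em] := to_stable_graph_iso I1 S1 Iz Sz iso; subst k' m'.
have gz : lgood D n z.
  by have /orbitP[p _ <-] := (iso_orbit I1 S1 Iz Sz).1 iso; apply: relabel_good.
have ECz : C = class_of z by rewrite /class_of zC reprK.
have zero k1 m1 : (k1 != k) || (m1 != m) ->
    \sum_(y : labelled N 'I_k1 'I_m1 | lgood D n y && (class_of y == C)) lterm y = 0.
  move=> ne; apply: big_pred0 => y; apply/negbTE/negP => /andP[gy].
  have [I2 S2] := lgood_stable gy; rewrite ECz => /class_eqP/(to_stable_graph_iso I2 S2 Iz Sz)[E1 E2].
  by rewrite E1 E2 !eqxx in ne.
rewrite (bigD1 (Ordinal kK)) //= [X in _ + X]big1 ?addr0 => [|k1 ne]; last first.
  by rewrite big1 // => m1 _; apply: zero; rewrite -val_eqE /= in ne; rewrite ne.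
rewrite (bigD1 (Ordinal mK)) //= [X in _ + X]big1 ?addr0 => [|m1 ne]; last first.
  by apply: zero; rewrite -val_eqE /= in ne; rewrite ne orbT.
by rewrite ECz; apply: orbit_sum.
Qed.

Theorem refined_chi_labelled : refined_chi g n =
  \sum_(k < K) \sum_(m < K) \sum_(x : labelled N 'I_k 'I_m | lgood D n x) lterm x.
Proof.
rewrite /refined_chi connected_classesE -fsbig_seq ?undup_uniq //.
rewrite (eq_big_seq _ (fun C CC => esym (class_sum CC))).
rewrite exchange_big /=; apply: eq_bigr => k _.
rewrite exchange_big /=; apply: eq_bigr => m _.
under eq_bigr => C _ do rewrite big_mkcondr.
rewrite exchange_big /=; apply: eq_bigr => x gx.
rewrite -big_mkcond /= -big_filter.
have -> : [seq C <- classes | class_of x == C] = [:: class_of x]; last by rewrite big_seq1.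
apply: perm_small_eq => //; apply: uniq_perm; rewrite ?filter_uniq ?undup_uniq // => C.
rewrite mem_filter inE eq_sym; case: eqP => //= ->; apply/mem_classes.
by exists k, m, x; have /andP[] := lgood_bound gx.
Qed.

End Sum.

End Classes.

(** * The recursion *)
Section Coef.
Variable N : nat.

Lemma coef_conn_gf_lterm D n : (fpscoef (conn_gf N) D)`_n =
  \sum_(k < (3 * D).+1) \sum_(m < (3 * D).+1)
    \sum_(x : labelled N 'I_k 'I_m | lgood D n x) lterm x.
Proof.
rewrite /= coef_sum; apply: eq_bigr => k _; rewrite coef_sum; apply: eq_bigr => m _.
rewrite /conn_coef coef_conn_sum big_distrr coef_sum /= big_mkcond [RHS]big_mkcond.
apply: eq_bigr => x _; rewrite /lgood.
case: (boolP (lstab x)) => [st|/forallPn[v us]]; last first.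
  rewrite !andbF; case: ifP => // _.
  have /eqP -> : lcoef x == 0 by apply: contraR us => /lcoef_stable.
  by rewrite mulr0 coef0.
case: (lvalid x) (lconn x) (lstat neg_euler x == D) => -[] [] //=.
rewrite /lcoef /edge_part /inv_facts mulrA -rmorphM /= coefCM -rmorphXn coefMC coefXn eq_sym.
case: eqP => _; last by rewrite mul0r mulr0.
by rewrite mul1r mul_polyC /lterm mulrC.
Qed.

Lemma coef_conn_gf_refined g n D : (g < N)%N -> (D + 2 = 2 * g + n)%N ->
  (fpscoef (conn_gf N) D)`_n = refined_chi g n.
Proof. by move=> gN gD; rewrite coef_conn_gf_lterm (refined_chi_labelled gN gD). Qed.

(** The genus of a connected graph is a natural number, so the exponents of t and y
    in F are linked. *)
Lemma coef_conn_gf_zero n D : (forall g, (D + 2 <> 2 * g + n)%N) -> (fpscoef (conn_gf N) D)`_n = 0.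
Proof.
move=> ng; rewrite coef_conn_gf_lterm; apply: big1 => k _; apply: big1 => m _.
apply: big_pred0 => x; apply/negbTE/negP => /and5P[Iv St c /eqP sD /eqP en].
by have := to_stable_graph_genus Iv St c; rewrite sD en => /esym/ng.
Qed.

End Coef.

Lemma refined_chi_unstable g n : (2 * g + n < 3)%N -> refined_chi g n = 0.
Proof.
move=> us; rewrite /refined_chi.
have -> : connected_iso_classes g n = classical_sets.set0; last by rewrite fsbig_set0.
apply/seteqP; split=> // C [G [cG eg en] _].
have := genus_connected cG; rewrite eg -external_n_ext en.
have /andP[nv0 _] := cG; rewrite (bigD1 (Ordinal nv0)) //= => E.
have : (2 < 2 * vgenus (Ordinal nv0) + degree_at (@hroot G) (Ordinal nv0))%N := stability _.
by move: E; rewrite /neg_euler; move: (vgenus _) (degree_at _ _) => a b; lia.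
Qed.

(** At D = 0 there are further terms, from the graphs whose only vertex has type
    (0,3) or (1,1). *)
Lemma coef_conn_gf_rec N D n : (1 < N)%N -> (0 < D)%N ->
  (fpscoef (conn_gf N) D.+1)`_n.+1 *+ n.+1 =
  (2^-1)%:P * ('X * ((fpscoef (conn_gf N) D)`_n *+ n) *+ 2
    + 'X ^+ 2 * ((fpscoef (conn_gf N) D)`_n.+2 *+ n.+2 *+ n.+1
      + \sum_(E < D.+1) \sum_(j < n.+1)
          ((fpscoef (conn_gf N) E)`_j.+1 *+ j.+1) *
          ((fpscoef (conn_gf N) (D - E))`_(n - j).+1 *+ (n - j).+1)))
  - (fpscoef (conn_gf N) D)`_n *+ D.
Proof.
move=> N2 D0; have := congr1 (fun f : fps RR => (fpscoef f D.+1)`_n) (quadratic_conn_gf N2).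
have dyE f E : fpscoef (fpsmap deriv f) E = (fpscoef f E : RR)^`() by [].
have cD c : fpscoef (fpsconst c : fps RR) D = 0 by case: D D0.
rewrite coefX_fps coefD_fps coefN_fps coefD_fps coefC_fps dyE coef_deriv => ->.
rewrite cD addr0 coefB coefMn; congr (_ - _).
rewrite !coefD_fps !expr2 -!mulrA !coefC_fps !cD mulr0 add0r addr0.
rewrite !coefD_fps coefM_fps !dyE coefCM; congr (_ * _).
have cXD (p : RR) : ('X * p^`())`_n = p`_n *+ n by rewrite coefXM coef_deriv; case: n.
rewrite !(mulrCA 'X 'X%:P) !coefD !coefCM cXD -mulr2n coefD !coef_deriv.
congr (_ + _ * (_ * (_ + _))).
rewrite coef_sum; apply: eq_bigr => E _; rewrite coefM; apply: eq_bigr => j _.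
by rewrite !dyE !coef_deriv.
Qed.

(** Only pairs of exponents with E + 2 = 2 i + j + 1 for a genus [i] contribute to the
    convolution, and this replaces the sum over exponents by one over genera. *)
Lemma refined_chi_rec g n : (0 < g)%N -> (0 < n)%N ->
  refined_chi g n.+1 *+ n.+1 =
  (2^-1)%:P * ('X * (refined_chi g n *+ n) *+ 2
    + 'X ^+ 2 * (refined_chi g.-1 n.+2 *+ n.+2 *+ n.+1
      + \sum_(i < g.+1) \sum_(j < n.+1)
          (refined_chi i j.+1 *+ j.+1) * (refined_chi (g - i) (n - j).+1 *+ (n - j).+1)))
  - refined_chi g n *+ (2 * g + n - 2).
Proof.
(* All the genera involved are at most g, and N must exceed them and 1. *)
move=> g0 n0; pose N := g.+2; pose D := (2 * g + n - 2)%N.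
have cF i m E : (i <= g)%N -> (E + 2 = 2 * i + m)%N -> (fpscoef (conn_gf N) E)`_m = refined_chi i m.
  by move=> ig; apply: coef_conn_gf_refined; rewrite /N; lia.
have := @coef_conn_gf_rec N D n isT; rewrite -/D.
rewrite (cF g n.+1) ?(cF g n) ?(cF g.-1 n.+2); try by rewrite /D; lia.
move=> ->; last by rewrite /D; lia.
congr (_ * (_ + _ * (_ + _)) - _).
rewrite exchange_big [RHS]exchange_big /=; apply: eq_bigr => j _; rewrite -/D.
have jn : (j <= n)%N by rewrite -ltnS.
pose G E := (fpscoef (conn_gf N) E)`_j.+1 *+ j.+1 * ((fpscoef (conn_gf N) (D - E))`_(n - j).+1 *+ (n - j).+1).
transitivity (\sum_(E < D.+1) \sum_(i < g.+1) if (E + 1 == 2 * i + j)%N then G E else 0).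
  apply: eq_bigr => E _; have ED : (E <= D)%N by rewrite -ltnS.
  rewrite -big_mkcond /=.
  case: (pickP (fun i : 'I_g.+1 => (E + 1 == 2 * i + j)%N)) => [i /= /eqP Ei|no].
    rewrite [RHS](big_pred1 i) // => i' /=; apply/eqP/eqP => [Ei'|->//].
    by apply: val_inj => /=; lia.
  rewrite [RHS]big_pred0 //.
  have [Ei|ni] := boolP (odd (E + 1 + j) || (E + 1 < j))%N.
    rewrite coef_conn_gf_zero ?mul0rn ?mul0r // => i Ei'; move: Ei.
    have -> : (E + 1 + j = 2 * (i + j))%N by lia.
    by rewrite oddM /=; lia.
  rewrite [X in _ * (X *+ _)]coef_conn_gf_zero ?mul0rn ?mulr0 // => i Ei'.
  move: ni; rewrite negb_or -leqNgt => /andP[ev le].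
  have := odd_double_half (E + 1 - j); rewrite oddB // -oddD (negbTE ev) add0n -muln2.
  move: (_./2) => h hE; have iP : (h < g.+1)%N by move: hE le Ei' ED; rewrite /D; lia.
  by have := no (Ordinal iP); move: hE le; rewrite /=; lia.
rewrite exchange_big /=; apply: eq_bigr => i _; rewrite -big_mkcond /=.
have ig : (i <= g)%N by rewrite -ltnS.
have [ok|bad] := boolP ((0 < 2 * i + j) && (2 * i + j < 2 * g + n))%N.
  have EP : (2 * i + j - 1 < D.+1)%N by rewrite /D; lia.
  rewrite [LHS](big_pred1 (Ordinal EP)) => [|E].
    rewrite /G /= (cF i) ?(cF (g - i)%N) //; rewrite /D; lia.
  by apply/eqP/eqP => [Ei|->] /=; [apply: val_inj => /=; lia | lia].
rewrite [LHS]big_pred0 => [|E]; last by have := ltn_ord E; rewrite {2}/D; lia.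
have [z|z] : (2 * i + j.+1 < 3)%N \/ (2 * (g - i) + (n - j).+1 < 3)%N by lia.
  by rewrite refined_chi_unstable // mul0rn mul0r.
by rewrite [refined_chi (g - i) _]refined_chi_unstable // mul0rn mulr0.
Qed.

Definition free_energy g : fps {poly rat} := Fps (fun n => refined_chi g n).

(** In genus 0 the unstable terms of [free_energy] vanish, so they may be included. *)
Lemma phi_free_energy g : phi g = kappa * fpsderiv (free_energy g) + (if g == 0%N then fpsvar else 0).
Proof.
apply: fpsP => n; rewrite coefD_fps coefC_fps.
have E : n.+1%:R * 'X * refined_chi g n.+1 = 'X * fpscoef (fpsderiv (free_energy g)) n.
  by rewrite /= -mulrA mulr_natl mulrnAr.
case: g E => [|g] E; last by rewrite coef0_fps addr0 -E.
rewrite eqxx addrC [LHS]coefD_fps -E; congr (_ + _) => /=.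
by case: ltnP => // n2; rewrite refined_chi_unstable ?mulr0 //; lia.
Qed.

Lemma sum_pick (R : nmodType) (F : nat -> R) n m : (m <= n)%N ->
  \sum_(i < n.+1) F i *+ (i == m :> nat) = F m.
Proof.
move=> mn; rewrite (bigD1 (Ordinal (mn : (m < n.+1)%N))) //= eqxx mulr1n big1 ?addr0 // => i.
by rewrite -val_eqE /= => /negbTE->.
Qed.

Lemma fpsderiv_eq (R : comNzRingType) (f h : fps R) :
  (forall n, (0 < n)%N -> fpscoef f n = fpscoef h n) -> fpsderiv f = fpsderiv h.
Proof. by move=> e; apply: fpsP => n /=; rewrite e. Qed.

(** [refined_chi_rec] for all positive [n]; the derivative discards the case n = 0,
    where further constants appear. *)
Lemma free_energy_eq g : (0 < g)%N ->
  fpsderiv ((1 + fpsvar - kappa * fpsvar) * fpsderiv (free_energy g) + (free_energy g *+ (2 * g) - free_energy g *+ 2)) =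
  fpsderiv (fpsconst (2^-1)%:P * (kappa ^+ 2 * (fpsderiv (fpsderiv (free_energy g.-1))
    + \sum_(i < g.+1) fpsderiv (free_energy i) * fpsderiv (free_energy (g - i))))).
Proof.
move=> g0; apply: fpsderiv_eq => n n0.
have half (p : {poly rat}) : (2^-1)%:P * (p *+ 2) = p.
  by rewrite -[p *+ 2]mulr_natl mulrA -(rmorph_nat polyC) -rmorphM mulVf // mul1r.
have := refined_chi_rec g0 n0; rewrite mulrDr half => E.
rewrite mulrBl mulrDl mul1r -mulrA 2!coefD_fps coefN_fps coefD_fps coefC_fps.
rewrite [fpscoef (fpsderiv _) n]/= {}E !expr2 -!mulrA !coefC_fps coefD_fps.
rewrite [in RHS]coefD_fps coef_sum_fps coefN_fps !coefMn_fps.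
under [X in _ = _ * (_ * (_ * (_ + X)))]eq_bigr => i _ do rewrite coefM_fps.
have -> : fpscoef (fpsvar * fpsderiv (free_energy g)) n = refined_chi g n *+ n.
  by rewrite coefX_fps; case: n n0.
have -> : refined_chi g n *+ (2 * g + n - 2) =
    refined_chi g n *+ (2 * g) + refined_chi g n *+ n - refined_chi g n *+ 2.
  by rewrite mulrnBr ?mulrnDr //; lia.
rewrite /=; ring.
Qed.

(** The equation of [free_energy_eq] multiplied by kappa; [P1], [P2], [X], [S] stand for
    the derivatives of the series and for half the derivative of the quadratic sum. *)
Lemma genus_recursion_arith (R : comNzRingType) (c k y P1 P2 X S n : R) : c *+ 2 = 1 ->
  (1 - k) * P1 + (1 + y - k * y) * P2 + (n * P1 - P1 *+ 2) = c * (k ^+ 2 * (X + S *+ 2)) ->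
  (y + 1) * (k * P2) + (n - 1) * (k * P1)
  = c * k ^+ 2 * (k * X) + k * (k ^+ 2 * S + k * y * P2 + k * P1).
Proof.
move=> c2 E; apply/eqP; rewrite -subr_eq0; apply/eqP.
transitivity (k * ((1 - k) * P1 + (1 + y - k * y) * P2 + (n * P1 - P1 *+ 2)
  - c * (k ^+ 2 * (X + S *+ 2))) + k ^+ 3 * S * (c *+ 2 - 1)); first by ring.
by rewrite E c2 !subrr !mulr0 addr0.
Qed.

Theorem theorem3p10 (g : nat) (hg : (1 <= g)%N) :
  (fpsvar + 1) * fpsderiv (phi g) + ((2 * g)%:R - 1) * phi g
  = fpsconst (2^-1)%:P * kappa ^+ 2 * fpsderiv (fpsderiv (phi g.-1))
    + kappa * \sum_(i < g.+1) fpsderiv (phi i) * phi (g - i).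
Proof.
have d := fpsderiv_derivation {poly rat}.
have dk : fpsderiv kappa = 0 :> fps {poly rat}.
  by apply: fpsP => n /=; rewrite mulr0n !mul0rn.
have dv : fpsderiv fpsvar = 1 :> fps {poly rat}.
  by apply: fpsP => -[|n] /=; rewrite ?mulr1n ?mul0rn.
have dh : fpsderiv (fpsconst (2^-1)%:P) = 0 :> fps {poly rat}.
  by apply: fpsP => n /=; rewrite mulr0n !mul0rn.
have h2 : fpsconst (2^-1)%:P *+ 2 = 1 :> fps {poly rat}.
  apply: fpsP => -[|n]; rewrite coefMn_fps /= ?mulr0n ?mul0rn // !mulr1n.
  by rewrite -polyCMn -[_^-1 *+ _]mulr_natl divff.
have dphi i : fpsderiv (phi i) = kappa * fpsderiv (fpsderiv (free_energy i)) + (i == 0%N)%:R.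
  rewrite phi_free_energy (derD d) (derM d) dk mul0r add0r; case: eqP => _; first by rewrite dv.
  by rewrite (der0 d).
have d2phi i : fpsderiv (fpsderiv (phi i)) = kappa * fpsderiv (fpsderiv (fpsderiv (free_energy i))).
  rewrite dphi (derD d) (derM d) dk mul0r add0r.
  by rewrite (derMn d) (der1 d) mul0rn addr0.
have phig : phi g = kappa * fpsderiv (free_energy g) by rewrite phi_free_energy (gtn_eqF hg) addr0.
have dphig : fpsderiv (phi g) = kappa * fpsderiv (fpsderiv (free_energy g)).
  by rewrite dphi (gtn_eqF hg) addr0.
have L : fpsderiv ((1 + fpsvar - kappa * fpsvar) * fpsderiv (free_energy g) +
      (free_energy g *+ (2 * g) - free_energy g *+ 2)) =
    (1 - kappa) * fpsderiv (free_energy g) + (1 + fpsvar - kappa * fpsvar) * fpsderiv (fpsderiv (free_energy g))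
    + ((2 * g)%:R * fpsderiv (free_energy g) - fpsderiv (free_energy g) *+ 2).
  rewrite (derD d) (derM d) (derD d) (derN d) (derD d) (derM d kappa) dk dv (der1 d).
  by rewrite (derD d) (derN d) !(derMn d) -[_ *+ (2 * g)]mulr_natl; ring.
pose S := \sum_(i < g.+1) fpsderiv (fpsderiv (free_energy i)) * fpsderiv (free_energy (g - i)).
have dS : fpsderiv (\sum_(i < g.+1) fpsderiv (free_energy i) * fpsderiv (free_energy (g - i))) = S *+ 2.
  rewrite (der_sum d); under eq_bigr => i _ do rewrite (derM d).
  rewrite big_split mulr2n; congr (_ + _) => /=.
  rewrite (reindex_inj rev_ord_inj) /=; apply: eq_bigr => i _.
  have il : (i <= g)%N by rewrite -ltnS.
  by rewrite subSS (subKn il) mulrC.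
have -> : \sum_(i < g.+1) fpsderiv (phi i) * phi (g - i) =
    kappa ^+ 2 * S + kappa * fpsvar * fpsderiv (fpsderiv (free_energy g)) + kappa * fpsderiv (free_energy g).
  transitivity (\sum_(i < g.+1) (kappa ^+ 2 * (fpsderiv (fpsderiv (free_energy i)) * fpsderiv (free_energy (g - i)))
     + kappa * fpsvar * fpsderiv (fpsderiv (free_energy i)) *+ (i == g :> nat)
     + kappa * fpsderiv (free_energy (g - i)) *+ (i == 0%N :> nat))).
    apply: eq_bigr => i _; rewrite dphi phi_free_energy.
    case: (eqVneq (i : nat) 0%N) => [->|i0].
      by rewrite subn0 (gtn_eqF hg) eq_sym (gtn_eqF hg) !mulr0n !mulr1n; ring.
    case: (eqVneq (i : nat) g) => [->|ig].
      by rewrite subnn eqxx !mulr0n !mulr1n; ring.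
    have -> : (g - i == 0)%N = false by have := ltn_ord i; move: ig; lia.
    by rewrite !mulr0n; ring.
  rewrite !big_split -big_distrr /= -/S; congr (_ + _ + _).
    exact: (sum_pick (fun i => kappa * fpsvar * fpsderiv (fpsderiv (free_energy i))) (leqnn g)).
  have := sum_pick (fun i => kappa * fpsderiv (free_energy (g - i))) (leq0n g).
  by rewrite subn0.
rewrite d2phi dphig phig; apply: (genus_recursion_arith h2); rewrite -L (free_energy_eq hg).
rewrite (derM d) dh mul0r add0r (derM d) (derX d) dk mulr0 mul0rn mul0r add0r.
by rewrite (derD d) dS.
Qed.
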